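(* There exist a finitely generated abelian-by-cyclic group $\mathcal{A} \rtimes \mathbb{Z}$, an integer $m$, and elements $h_1, \ldots, h_m \in \mathcal{A} \rtimes \mathbb{Z}$, such that the following problem is undecidable. Input: an element $h_0 \in \mathcal{A} \rtimes \mathbb{Z}$. Question: do there exist $g_0, g_1, \ldots, g_m \in \mathcal{A} \rtimes \mathbb{Z}$ such that $$(g_0 h_0 g_0^{-1})(g_1 h_1 g_1^{-1}) \cdots (g_m h_m g_m^{-1}) = e\,?$$ A fortiori, the problem of solving a single quadratic equation is undecidable in the group $\mathcal{A} \rtimes \mathbb{Z}$.
   Context: $\mathbb{Z}[X^{\pm}] = \mathbb{Z}[X, X^{-1}]$. A group $G$ is abelian-by-cyclic if it has an abelian normal subgroup $A$ with $G/A \cong \mathbb{Z}$. Every finitely generated abelian-by-cyclic group is represented as a semidirect product $\mathcal{A} \rtimes \mathbb{Z} = \{(\boldsymbol{a}, z) \mid \boldsymbol{a} \in \mathcal{A}, z \in \mathbb{Z}\}$, where $\mathcal{A}$ is a finitely presented $\mathbb{Z}[X^{\pm}]$-module, with group law $(\boldsymbol{a}, z)\cdot(\boldsymbol{a}', z') = (\boldsymbol{a} + X^z \cdot \boldsymbol{a}', z + z')$, inverse $(\boldsymbol{a},z)^{-1} = (-X^{-z}\cdot\boldsymbol{a}, -z)$ and neutral element $e = (\boldsymbol{0}, 0)$. A finitely presented module is a quotient $M/N$ of finitely generated submodules $N \subseteq M \subseteq \mathbb{Z}[X^{\pm}]^D$ for some $D \in \mathbb{N}$, and its elements are given by representative vectors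 in $M$; group elements are input as pairs $(\boldsymbol{a}, z)$. An equation over a group $G$ in variables $x_1, \ldots, x_n$ is given by a finite word $w$ over $\{x_1^{\pm 1}, \ldots, x_n^{\pm 1}\} \cup G$, and solving it means deciding whether some substitution $x_i \mapsto g_i \in G$ makes the product $w(g_1,\dots,g_n)$ equal to $e$; it is quadratic if for each $i$ the numbers of occurrences of $x_i$ and of $x_i^{-1}$ in $w$ sum to two. *)

(* Defs.v *)
From HB Require Import structures.
From Stdlib Require Cantor.
From mathcomp Require Import all_boot all_order all_algebra.
From mathcomp Require Import boolp.

Set Implicit Arguments.
Unset Strict Implicit.
Unset Printing Implicit Defensive.

Import GRing.Theory.

Local Open Scope ring_scope.

(* Kleene's partial recursive functions, made unary by Cantor pairing. *)

Definition cpair (a b : nat) : nat := Stdlib.Arith.Cantor.to_nat (a, b).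

Inductive partrec : Type :=
  | PR_zero
  | PR_succ
  | PR_fst
  | PR_snd
  | PR_pair of partrec & partrec
  | PR_comp of partrec & partrec
  | PR_rec of partrec & partrec
  | PR_min of partrec.

(* [computes f n r]: the partial function [f] is defined at [n], with value
   [r].  [PR_rec f g] is primitive recursion with base [f], step [g] and
   argument (parameter, counter); [PR_min f] maps [a] to the least [k] such
   that [f] vanishes at (a, k), provided [f] is defined at all smaller ones. *)
Inductive computes : partrec -> nat -> nat -> Prop :=
  | C_zero n : computes PR_zero n 0
  | C_succ n : computes PR_succ n n.+1
  | C_fst a b : computes PR_fst (cpair a b) a
  | C_snd a b : computes PR_snd (cpair a b) b
  | C_pair f g n a b :
      computes f n a -> computes g n b -> computes (PR_pair f g) n (cpair a b)
  | C_comp f g n a b :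
      computes g n a -> computes f a b -> computes (PR_comp f g) n b
  | C_rec0 f g a r : computes f a r -> computes (PR_rec f g) (cpair a 0) r
  | C_recS f g a n r s :
      computes (PR_rec f g) (cpair a n) r ->
      computes g (cpair a (cpair n r)) s ->
      computes (PR_rec f g) (cpair a n.+1) s
  | C_min f a k (v : nat -> nat) :
      computes f (cpair a k) 0 ->
      (forall i, (i < k)%N -> computes f (cpair a i) (v i).+1) ->
      computes (PR_min f) a k.

(* Nothing is asked of [f] at numbers that encode no instance. *)
Definition decidable_problem (T : Type) (enc : T -> nat) (yes : T -> Prop) :=
  exists f : partrec, forall x : T,
    (yes x -> computes f (enc x) 1) /\ (~ yes x -> computes f (enc x) 0).

Definition enc_int (z : int) : nat :=
  match z with Posz n => n.*2 | Negz n => n.*2.+1 end.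

Definition enc_pair (A B : Type) (ea : A -> nat) (eb : B -> nat) (p : A * B) :=
  cpair (ea p.1) (eb p.2).

Definition enc_sum (A B : Type) (ea : A -> nat) (eb : B -> nat) (s : A + B) :=
  match s with inl a => (ea a).*2 | inr b => (eb b).*2.+1 end.

Definition enc_seq (A : Type) (ea : A -> nat) (s : seq A) : nat :=
  foldr (fun x c => (cpair (ea x) c).+1) 0%N s.

(* Z[X, X^-1], as the subring of the fraction field of Z[X] formed by the
   finite sums of c X^e with c, e in Z.  A pair (c, e) stands for c X^e. *)

Definition lpoly_sum (s : seq (int * int)) : {fraction {poly int}} :=
  \sum_(t <- s) (tofrac 'X ^ t.2) *~ t.1.

Definition is_laurent (f : {fraction {poly int}}) : bool :=
  `[< exists s, f = lpoly_sum s >].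

Lemma is_laurentP f : reflect (exists s, f = lpoly_sum s) (is_laurent f).
Proof. exact: asboolP. Qed.

Lemma fracX_neq0 : tofrac 'X != 0 :> {fraction {poly int}}.
Proof. by rewrite tofrac_eq0 polyX_eq0. Qed.

Lemma lpoly_sum_cat s t : lpoly_sum (s ++ t) = lpoly_sum s + lpoly_sum t.
Proof. by rewrite /lpoly_sum big_cat. Qed.

Lemma lpoly_sum1 c e : lpoly_sum [:: (c, e)] = (tofrac 'X ^ e) *~ c.
Proof. by rewrite /lpoly_sum big_seq1. Qed.

Lemma is_laurent_closed : subring_closed is_laurent.
Proof.
have oppP (s : seq (int * int)) :
    - lpoly_sum s = lpoly_sum [seq (- t.1, t.2) | t <- s].
  rewrite /lpoly_sum big_map -sumrN; apply: eq_bigr => t _ /=.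
  by rewrite mulrNz.
split.
- by apply/is_laurentP; exists [:: (1, 0)]; rewrite lpoly_sum1.
- move=> _ _ /is_laurentP[s ->] /is_laurentP[t ->]; apply/is_laurentP.
  by rewrite oppP -lpoly_sum_cat; eexists.
move=> _ _ /is_laurentP[s ->] /is_laurentP[t ->]; apply/is_laurentP.
exists [seq (u.1 * v.1, u.2 + v.2) | u <- s, v <- t].
rewrite /lpoly_sum big_allpairs_dep mulr_suml; apply: eq_bigr => u _.
rewrite mulr_sumr; apply: eq_bigr => v _ /=.
by rewrite expfzDr ?fracX_neq0// mulrzAr mulrzAl mulrzA.
Qed.

HB.instance Definition _ :=
  GRing.isSubringClosed.Build {fraction {poly int}} is_laurent
    is_laurent_closed.

Record laurent := Laurent {
  laurent_val :> {fraction {poly int}};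
  laurent_valP : is_laurent laurent_val }.

HB.instance Definition _ := [isSub for laurent_val].
HB.instance Definition _ := [Choice of laurent by <:].
HB.instance Definition _ := [SubChoice_isSubComNzRing of laurent by <:].

Lemma lpoly_sum_laurent s : is_laurent (lpoly_sum s).
Proof. by apply/is_laurentP; exists s. Qed.

Definition lpoly (s : seq (int * int)) : laurent :=
  Laurent (lpoly_sum_laurent s).

Definition lX (z : int) : laurent := lpoly [:: (1, z)].

Lemma lXD y z : lX (y + z) = lX y * lX z.
Proof. by apply: val_inj; rewrite /= !lpoly_sum1 !mulr1z expfzDr ?fracX_neq0. Qed.

Lemma lX0 : lX 0 = 1.
Proof. by apply: val_inj; rewrite /= lpoly_sum1. Qed.

Section Submodule.
Variables (D n : nat) (G : 'M[laurent]_(n, D)).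

(* The submodule generated by the rows of G. *)
Definition submod (v : 'rV[laurent]_D) : bool :=
  `[< exists c : 'rV[laurent]_n, v = c *m G >].

Lemma submodP v : reflect (exists c, v = c *m G) (submod v).
Proof. exact: asboolP. Qed.

Lemma submod_is_closed : submod_closed submod.
Proof.
split=> [|a _ _ /submodP[c ->] /submodP[d ->]]; apply/submodP.
  by exists 0; rewrite mul0mx.
by exists (a *: c + d); rewrite mulmxDl scalemxAl.
Qed.

HB.instance Definition _ :=
  GRing.isSubmodClosed.Build laurent 'rV[laurent]_D submod submod_is_closed.

Record submod_type := Submod {
  submod_val :> 'rV[laurent]_D;
  submod_valP : submod submod_val }.

HB.instance Definition _ := [isSub for submod_val].
HB.instance Definition _ := [Choice of submod_type by <:].
HB.instance Definition _ := [SubChoice_isSubLmodule of submod_type by <:].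

End Submodule.

(* The module M/N, where M and N are generated by the rows of [fp_M], [fp_N]. *)
Record fp_module := FpModule {
  fp_dim : nat;
  fp_m : nat;
  fp_n : nat;
  fp_M : 'M[laurent]_(fp_m, fp_dim);
  fp_N : 'M[laurent]_(fp_n, fp_dim);
  fp_sub : forall v, submod fp_N v -> submod fp_M v }.

Section FpQuotient.
Variable P : fp_module.
Local Notation M := (submod_type (fp_M P)).

Definition fp_relations (v : M) : bool := submod (fp_N P) (val v).

Lemma fp_relations_closed : submod_closed fp_relations.
Proof.
have [N0 Nlin] := submod_is_closed (fp_N P).
by split=> [|a u v Nu Nv]; [exact: N0 | exact: Nlin].
Qed.

HB.instance Definition _ :=
  GRing.isSubmodClosed.Build laurent M fp_relations fp_relations_closed.

Definition fp_Nsub := GRing.ZmodClosed.clone M fp_relations _.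

Definition fp_quot : Type := Quotient.quot fp_Nsub.

HB.instance Definition _ := Choice.on fp_quot.
HB.instance Definition _ := GRing.Zmodule.on fp_quot.

Definition fp_pi (v : M) : fp_quot := \pi_(Quotient.quot fp_Nsub)%qT v.

Definition fp_scale (a : laurent) (x : fp_quot) : fp_quot :=
  fp_pi (a *: (repr (x : Quotient.quot fp_Nsub))).

Lemma fp_piP u v : fp_pi u = fp_pi v <-> submod (fp_N P) (val u - val v).
Proof.
split=> [/eqP|] Euv; last apply/eqP; move: Euv;
  by rewrite /fp_pi -Quotient.idealrBE.
Qed.

Lemma fp_piD : {morph fp_pi : u v / u + v}.
Proof. by move=> u v; rewrite /fp_pi raddfD. Qed.

Lemma fp_piZ a v : fp_pi (a *: v) = fp_scale a (fp_pi v).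
Proof.
apply/eqP; rewrite /fp_scale /fp_pi -Quotient.idealrBE -scalerBr rpredZ//.
by rewrite Quotient.idealrBE reprK.
Qed.

Lemma fp_pi_surj x : exists v, x = fp_pi v.
Proof. by exists (repr (x : Quotient.quot fp_Nsub)); rewrite /fp_pi reprK. Qed.

Lemma fp_scaleA a b x : fp_scale a (fp_scale b x) = fp_scale (a * b) x.
Proof. by have [v ->] := fp_pi_surj x; rewrite -!fp_piZ scalerA. Qed.

Lemma fp_scale1 : left_id 1 fp_scale.
Proof. by move=> x; have [v ->] := fp_pi_surj x; rewrite -fp_piZ scale1r. Qed.

Lemma fp_scaleDr : right_distributive fp_scale +%R.
Proof.
move=> a x y; have [u ->] := fp_pi_surj x; have [v ->] := fp_pi_surj y.
by rewrite -fp_piD -!fp_piZ -fp_piD scalerDr.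
Qed.

Lemma fp_scaleDl x : {morph fp_scale^~ x : a b / a + b}.
Proof.
by move=> a b; have [v ->] := fp_pi_surj x; rewrite -!fp_piZ -fp_piD scalerDl.
Qed.

HB.instance Definition _ := GRing.Zmodule_isLmodule.Build laurent fp_quot
  fp_scaleA fp_scale1 fp_scaleDr fp_scaleDl.

End FpQuotient.

Section SemidirectProduct.
Variable A : lmodType laurent.

Record sdprodZ := SdprodZ { sd_vec : A; sd_exp : int }.

Definition pair_of_sdprodZ (x : sdprodZ) := (sd_vec x, sd_exp x).
Definition sdprodZ_of_pair (p : A * int) := SdprodZ p.1 p.2.

Lemma pair_of_sdprodZK : cancel pair_of_sdprodZ sdprodZ_of_pair.
Proof. by case. Qed.

HB.instance Definition _ := Choice.copy sdprodZ (can_type pair_of_sdprodZK).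

Definition sd_one := SdprodZ 0 0.
Definition sd_mul x y :=
  SdprodZ (sd_vec x + lX (sd_exp x) *: sd_vec y) (sd_exp x + sd_exp y).
Definition sd_inv x :=
  SdprodZ (- (lX (- sd_exp x) *: sd_vec x)) (- sd_exp x).

Lemma sd_mulA : associative sd_mul.
Proof.
by move=> [a x] [b y] [c z]; rewrite /sd_mul /= lXD scalerDr scalerA !addrA.
Qed.

Lemma sd_mul1 : left_id sd_one sd_mul.
Proof. by move=> [a x]; rewrite /sd_mul /= lX0 scale1r !add0r. Qed.

Lemma sd_1mul : right_id sd_one sd_mul.
Proof. by move=> [a x]; rewrite /sd_mul /= scaler0 !addr0. Qed.

Lemma sd_mulV : left_inverse sd_one sd_inv sd_mul.
Proof. by move=> [a x]; rewrite /sd_mul /= !addNr. Qed.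

Lemma sd_Vmul : right_inverse sd_one sd_inv sd_mul.
Proof.
move=> [a x]; rewrite /sd_mul /= scalerN scalerA -lXD !subrr lX0 scale1r.
by rewrite subrr.
Qed.

HB.instance Definition _ :=
  isGroup.Build sdprodZ sd_mulA sd_mul1 sd_1mul sd_mulV sd_Vmul.

End SemidirectProduct.

Section GroupNotions.
Local Open Scope group_scope.

Definition finitely_generated (G : groupType) : Prop :=
  exists s : seq G, forall x : G, exists w : seq G,
    all (fun y => (y \in s) || (y^-1 \in s)) w /\ x = \prod_(y <- w) y.

(* The isomorphism G/A -> Z is given as a map on G inducing it: it is constant
   on the cosets of A, separates them, and is an onto homomorphism. *)
Definition abelian_by_cyclic (G : groupType) : Prop :=
  exists A : G -> Prop,
    [/\ A 1 /\ (forall x y, A x -> A y -> A (x * y^-1)),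
        forall x y, A x -> A y -> x * y = y * x,
        forall x g, A x -> A (g * x * g^-1)
      & exists phi : G -> int,
        [/\ forall x y, phi (x * y) = (phi x + phi y)%R,
            forall z, exists x, phi x = z
          & forall x y, phi x = phi y <-> A (x^-1 * y)]].

(* Words over the variables x_i, i < n, their inverses, and constants from T:
   [inl (i, false)] is x_i and [inl (i, true)] is its inverse. *)
Definition word (T : Type) (n : nat) := seq (('I_n * bool) + T).

Definition is_var (T : Type) (n : nat) (i : 'I_n) (l : ('I_n * bool) + T) :=
  if l is inl (j, _) then j == i else false.

Definition quadratic (T : Type) (n : nat) (w : word T n) : Prop :=
  forall i : 'I_n, count (is_var i) w = 2.

Definition letter_eval (T : Type) (G : groupType) (val : T -> G) (n : nat)
    (g : 'I_n -> G) (l : ('I_n * bool) + T) : G :=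
  match l with
  | inl (i, b) => if b then (g i)^-1 else g i
  | inr t => val t
  end.

Definition word_eval (T : Type) (G : groupType) (val : T -> G) (n : nat)
    (g : 'I_n -> G) (w : word T n) : G :=
  \prod_(l <- w) letter_eval val g l.

End GroupNotions.

Section Inputs.
Variable P : fp_module.

Definition input_row (c : (fp_dim P).-tuple (seq (int * int))) :
    'rV[laurent]_(fp_dim P) :=
  \row_j lpoly (tnth c j).

(* Every representative of a in M is an admissible input for (a, z). *)
Record elt_input := EltInput {
  ei_vec : (fp_dim P).-tuple (seq (int * int));
  ei_exp : int;
  ei_vecP : submod (fp_M P) (input_row ei_vec) }.

Definition elt_of_input (x : elt_input) : sdprodZ (fp_quot P) :=
  SdprodZ (fp_pi (Submod (ei_vecP x))) (ei_exp x).

Definition enc_elt_input (x : elt_input) : nat :=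
  cpair (enc_seq (enc_seq (enc_pair enc_int enc_int)) (ei_vec x))
        (enc_int (ei_exp x)).

Record quadratic_input := QuadraticInput {
  qi_vars : nat;
  qi_word : word elt_input qi_vars;
  qi_wordP : quadratic qi_word }.

Definition enc_quadratic_input (E : quadratic_input) : nat :=
  cpair (qi_vars E)
    (enc_seq (enc_sum (enc_pair (@nat_of_ord _) nat_of_bool) enc_elt_input)
       (qi_word E)).

Definition equation_solvable (E : quadratic_input) : Prop :=
  exists g : 'I_(qi_vars E) -> sdprodZ (fp_quot P),
    word_eval elt_of_input g (qi_word E) = 1%g.

End Inputs.

(* Main.v *)
(** If all the given elements lie in the abelian part of the group, then
  conjugation only multiplies them by powers of X, so the equation asks for
  exponents z_i such that the sum of the X^(z_i) h_i vanishes in the module.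
  Modulo (X - 1)^3, X^z is 1 + z (X - 1) + binom(z, 2) (X - 1)^2, and one
  well-chosen equation of this kind says exactly that s = x + y and w = x y.
  Taking a power of Z[X, 1/X]/(X - 1)^3 as module, every Diophantine equation
  thus becomes an instance with fixed h_1, ..., h_m, in which the parameter n of
  the equation occurs only in h_0, as the exponent of -X^n.

  So it remains to find an undecidable Diophantine set.  Exponentiation is
  Diophantine by Matiyasevich's argument with the solutions of
  x^2 - b x y + y^2 = 1; with it come binomial coefficients and factorials, and
  then bounded universal quantifiers, by coding witnesses modulo the coprime
  factors 1 + T/k of the binomial coefficient of T + n over n.  Hence the set of
  programs that output 0 at their own code is Diophantine, a computation being
  witnessed by a finite list of triples (program, argument, value) each of which
  follows from earlier ones.  By Lagrange's theorem on sums of four squares, the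
  unknowns may range over the integers. *)

From HB Require Import structures.
From Stdlib Require Cantor.
Require Import Defs.
From mathcomp Require Import all_boot all_order all_algebra.
From mathcomp Require Import boolp zify ring.

Set Implicit Arguments.
Unset Strict Implicit.
Unset Printing Implicit Defensive.

(** * Diophantine predicates on the naturals *)

(** Modulo (X - 1)^2 the class of X^z would be affine in z, and only linear systems could be
    expressed; the third power is the first at which a product appears, through binom(x + y, 2) -
    binom(x, 2) - binom(y, 2) = x y. As this defect involves the exponent x + y, addition and
    multiplication are imposed together. Each conjugator g_i multiplies all coordinates of h_i by
    the same power of X. So the module gets one coordinate per constraint and there is one h_i per
    unknown: coordinates share exponents, and a whole system fits into one equation. The conjugator
    of h_0 contributes a unit, which can be divided out. Exponents are signed, whence the passage
    through four squares. The detour through exponentials serves the bounded quantifiers, which let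
    a computation of unknown length be checked step by step. *)

Inductive pexp : Type :=
  | Cst of nat
  | Par of nat
  | Ex of nat
  | Add of pexp & pexp
  | Mul of pexp & pexp.

Notation env := (nat -> nat).

Fixpoint peval (v w : env) (e : pexp) : nat :=
  match e with
  | Cst c => c
  | Par i => v i
  | Ex i => w i
  | Add a b => peval v w a + peval v w b
  | Mul a b => peval v w a * peval v w b
  end.

Fixpoint psubst (s t : nat -> pexp) (e : pexp) : pexp :=
  match e with
  | Cst c => Cst c
  | Par i => s i
  | Ex i => t i
  | Add a b => Add (psubst s t a) (psubst s t b)
  | Mul a b => Mul (psubst s t a) (psubst s t b)
  end.

Lemma peval_subst v w s t e :
  peval v w (psubst s t e) =
  peval (fun i => peval v w (s i)) (fun i => peval v w (t i)) e.
Proof. by elim: e => //= a -> b ->. Qed.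

Fixpoint pbound (e : pexp) : nat :=
  match e with
  | Cst c => 0
  | Par i => i.+1
  | Ex i => i.+1
  | Add a b | Mul a b => maxn (pbound a) (pbound b)
  end.

Lemma eq_peval e v v' w w' :
    (forall i, i < pbound e -> v i = v' i) ->
    (forall i, i < pbound e -> w i = w' i) ->
  peval v w e = peval v' w' e.
Proof.
elim: e => //= [i Hv _|i _ Hw|a IHa b IHb Hv Hw|a IHa b IHb Hv Hw];
  rewrite ?Hv ?Hw // (IHa, IHb) ?(IHa, IHb) // => i lt_i;
  by rewrite ?Hv ?Hw // leq_max lt_i ?orbT.
Qed.

(** Two expressions are compared because there is no subtraction on the naturals. Environments are
    infinite, which spares counting variables; each expression reads only finitely many of them. *)
Definition dioph (S : env -> Prop) : Prop :=
  exists e1 e2, forall v, S v <-> exists w, peval v w e1 = peval v w e2.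

Definition shift (v : env) : env := fun i => v i.+1.

Definition dfun (f : env -> nat) : Prop :=
  dioph (fun v => v 0 = f (shift v)).

Lemma dioph_iff S S' : (forall v, S v <-> S' v) -> dioph S -> dioph S'.
Proof.
by move=> eqS [e1 [e2 He]]; exists e1, e2 => v; rewrite -eqS He.
Qed.

Lemma dioph_ren r S : dioph S -> dioph (fun v => S (fun i => v (r i))).
Proof.
move=> [e1 [e2 He]]; pose sb := psubst (fun i => Par (r i)) Ex.
exists (sb e1), (sb e2) => v; rewrite He.
by split=> -[w Hw]; exists w; move: Hw; rewrite !peval_subst.
Qed.

(** A whole environment is quantified at once, interleaved with the free one by parity. Single
    quantifiers, substitution of functions and the codes of bounded quantifiers all reduce to
    this. *)
Lemma dioph_exfun S :
  dioph (fun v => S (fun i => v i.*2) (fun i => v i.*2.+1)) ->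
  dioph (fun v => exists a : env, S a v).
Proof.
move=> [e1 [e2 He]].
(* Among the new unknowns, the even places hold the quantified environment and the odd places the
   former unknowns. *)
pose sb := psubst (fun i => if odd i then Par i./2 else Ex i)
  (fun i => Ex i.*2.+1).
pose mix (a b : env) i := if odd i then b i./2 else a i./2.
have mixE a b : (fun i => mix a b i.*2) = a /\ (fun i => mix a b i.*2.+1) = b.
  by split; apply/funext => i;
     rewrite /mix /= odd_double ?doubleK ?uphalf_double.
have pE v w e : peval v w (sb e) =
    peval (mix (fun i => w i.*2) v) (fun i => w i.*2.+1) e.
  rewrite peval_subst; congr (peval _ _ _).
  apply/funext => i; rewrite /mix; case: ifPn => //= /negbTE Oi.
  by rewrite -{1}(odd_double_half i) Oi add0n.
exists (sb e1), (sb e2) => v; split.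
  move=> [a Sa]; have [Ea Ev] := mixE a v.
  have /(He (mix a v))[w Hw] :
      S (fun i => mix a v i.*2) (fun i => mix a v i.*2.+1) by rewrite Ea Ev.
  by exists (mix a w); have [Ea' Ew'] := mixE a w; rewrite !pE Ea' Ew'.
move=> [w]; rewrite !pE => Hw; exists (fun i => w i.*2).
have [Ea Ev] := mixE (fun i => w i.*2) v.
rewrite -Ea -[in X in S _ X]Ev.
by apply/(He (mix (fun i => w i.*2) v)); eexists; exact: Hw.
Qed.

Lemma dioph_ex S :
  dioph (fun v => S (v 0) (shift v)) -> dioph (fun v => exists x : nat, S x v).
Proof.
move=> dS; apply: dioph_iff (_ : dioph (fun v => exists a : env, S (a 0) v)).
  by move=> v; split=> [[a]|[x]]; [exists (a 0) | exists (fun=> x)].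
apply: dioph_exfun.
exact: (dioph_ren (fun i => if i is j.+1 then j.*2.+1 else 0) dS).
Qed.

(** Renaming the unknowns of S to even indices and those of T to odd ones makes them independent, so
    that one environment can witness both. *)
Lemma peval_pair S T : dioph S -> dioph T ->
  exists e1 e2 f1 f2, (forall v w1 w2, exists w,
   [/\ peval v w e1 = peval v w1 e1, peval v w e2 = peval v w1 e2,
     peval v w f1 = peval v w2 f1 & peval v w f2 = peval v w2 f2]) /\
   (forall v, (S v <-> exists w, peval v w e1 = peval v w e2) /\
              (T v <-> exists w, peval v w f1 = peval v w f2)).
Proof.
move=> [e1 [e2 He]] [f1 [f2 Hf]].
pose se := psubst Par (fun i => Ex i.*2).
pose sf := psubst Par (fun i => Ex i.*2.+1).
exists (se e1), (se e2), (sf f1), (sf f2); split.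
  move=> v w1 w2.
  exists (fun i => if odd i then w2 i./2.*2.+1 else w1 i./2.*2).
  rewrite !peval_subst /=.
  split; congr peval; apply/funext => i /=;
    by rewrite odd_double /= ?doubleK ?uphalf_double.
move=> v; rewrite He Hf; split; split.
- move=> [w Hw]; exists (fun i => w i./2); rewrite !peval_subst /=.
  by have -> : (fun i => w i.*2./2) = w
    by apply/funext => i; rewrite doubleK.
- by move=> [w]; rewrite !peval_subst /= => Hw; exists (fun i => w i.*2).
- move=> [w Hw]; exists (fun i => w i./2); rewrite !peval_subst /=.
  by have -> : (fun i => w (uphalf i.*2)) = w
    by apply/funext => i; rewrite uphalf_double.
- by move=> [w]; rewrite !peval_subst /= => Hw; exists (fun i => w i.*2.+1).
Qed.

(** This is (a - b)^2 + (c - d)^2 = 0 without subtraction, by the equality case of 2 a b <= a^2 +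
    b^2. *)
Lemma sum_sqr_eq0 a b c d :
  a * a + b * b + (c * c + d * d) = 2 * (a * b + c * d) <-> a = b /\ c = d.
Proof.
have [_] := leqif_add (nat_Cauchy a b) (nat_Cauchy c d).
rewrite -mulnDr -!mulnn => E; split=> [H|[-> ->]]; last first.
  by rewrite mulnDr !mul2n !addnn.
by move: E; rewrite H eqxx => /esym/andP[/eqP-> /eqP->].
Qed.

Lemma dioph_and S T : dioph S -> dioph T -> dioph (fun v => S v /\ T v).
Proof.
move=> dS dT; have [e1 [e2 [f1 [f2 [mrg He]]]]] := peval_pair dS dT.
(* (e1 - e2)^2 + (f1 - f2)^2 = 0 *)
pose sq e := Mul e e.
exists (Add (Add (sq e1) (sq e2)) (Add (sq f1) (sq f2))).
exists (Mul (Cst 2) (Add (Mul e1 e2) (Mul f1 f2))) => v.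
have [-> ->] := He v; split.
  move=> [[w1 E1] [w2 E2]]; have [w [H1 H2 H3 H4]] := mrg v w1 w2.
  by exists w => /=; rewrite H1 H2 H3 H4; apply/sum_sqr_eq0.
by move=> [w /sum_sqr_eq0[E F]]; split; exists w.
Qed.

Lemma dioph_or S T : dioph S -> dioph T -> dioph (fun v => S v \/ T v).
Proof.
move=> dS dT; have [e1 [e2 [f1 [f2 [mrg He]]]]] := peval_pair dS dT.
(* (e1 - e2) (f1 - f2) = 0 *)
exists (Add (Mul e1 f1) (Mul e2 f2)), (Add (Mul e1 f2) (Mul e2 f1)) => v.
have [-> ->] := He v; split.
  move=> [[w E]|[w E]]; exists w; rewrite /= E; lia.
move=> [w /= E].
have [E1|N1] := eqVneq (peval v w e1) (peval v w e2); first by left; exists w.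
by right; exists w; nia.
Qed.

Lemma dfun_var i : dfun (fun v => v i).
Proof. by exists (Par 0), (Par i.+1) => v; split=> [E|[]//]; exists v. Qed.

Lemma dfun_cst c : dfun (fun=> c).
Proof. by exists (Par 0), (Cst c) => v; split=> [E|[]//]; exists v. Qed.

Lemma dioph_true : dioph (fun=> True).
Proof. by exists (Cst 0), (Cst 0) => v; split=> // _; exists v. Qed.

Lemma dioph_all K S : (forall i, i < K -> dioph (S i)) ->
  dioph (fun v => forall i, i < K -> S i v).
Proof.
elim: K => [|K IHK] dS; first by apply: dioph_iff dioph_true.
have dK := IHK (fun i ltiK => dS i (ltnW ltiK)).
apply: dioph_iff (dioph_and (dS K (ltnSn K)) dK) => v.
split=> [[SK SlK] i|SlK].
  by rewrite ltnS leq_eqVlt => /predU1P[->|/SlK].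
by split=> [|i ltiK]; apply: SlK => //; exact: ltnW.
Qed.

(** Infinitely many graphs cannot be conjoined; only the variables read by the two expressions for S
    are tied to the functions [F i]. *)
Lemma dioph_subst F S : (forall i, dfun (F i)) -> dioph S ->
  dioph (fun v => S (fun i => F i v)).
Proof.
move=> dF dS; have [e1 [e2 He]] := dS.
pose K := maxn (pbound e1) (pbound e2).
apply: dioph_iff (_ : dioph (fun v => exists a : env,
    S a /\ forall i, i < K -> a i = F i v)) => [v|]; last first.
  apply: dioph_exfun; apply: dioph_and.
    exact: (dioph_ren (fun i => i.*2) dS).
  apply: dioph_all => i _.
  exact: (dioph_ren (fun j => if j is k.+1 then k.*2.+1 else i.*2) (dF i)).
split=> [[a [/He[w Hw] aF]]|SF]; last by exists (fun i => F i v).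
apply/He; exists w; rewrite -(@eq_peval e1 a _ w) -?(@eq_peval e2 a _ w) //;
  by move=> i lti; apply: aF; rewrite leq_max lti ?orbT.
Qed.

Lemma dfun_shift f : dfun f -> dfun (fun v => f (shift v)).
Proof.
exact: (@dioph_ren (fun i => if i is j.+1 then j.+2 else 0)).
Qed.

Definition scons A (x : A) (s : nat -> A) i := if i is j.+1 then s j else x.

Lemma dioph2 (R : nat -> nat -> Prop) f g :
  dioph (fun v => R (v 0) (v 1)) -> dfun f -> dfun g ->
  dioph (fun v => R (f v) (g v)).
Proof.
by move=> dR df dg; apply: (@dioph_subst (scons f (fun=> g))) dR => -[].
Qed.

Lemma dioph3 (R : nat -> nat -> nat -> Prop) f g h :
  dioph (fun v => R (v 0) (v 1) (v 2)) -> dfun f -> dfun g -> dfun h ->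
  dioph (fun v => R (f v) (g v) (h v)).
Proof.
move=> dR df dg dh.
by apply: (@dioph_subst (scons f (scons g (fun=> h)))) dR => -[|[]].
Qed.

Lemma dfun1 (F : nat -> nat) f :
  dioph (fun v => v 0 = F (v 1)) -> dfun f -> dfun (fun v => F (f v)).
Proof.
move=> dF df; apply: (dioph2 (R := fun x y => x = F y)) dF _ _.
  exact: dfun_var.
exact: dfun_shift.
Qed.

Lemma dfun2 (F : nat -> nat -> nat) f g :
  dioph (fun v => v 0 = F (v 1) (v 2)) -> dfun f -> dfun g ->
  dfun (fun v => F (f v) (g v)).
Proof.
move=> dF df dg; apply: (dioph3 (R := fun x y z => x = F y z)) dF _ _ _.
- exact: dfun_var.
- exact: dfun_shift.
exact: dfun_shift.
Qed.

Lemma dfun_add f g : dfun f -> dfun g -> dfun (fun v => f v + g v).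
Proof.
apply: dfun2; exists (Par 0), (Add (Par 1) (Par 2)) => v.
by split=> [|[]//]; exists v.
Qed.

Lemma dfun_mul f g : dfun f -> dfun g -> dfun (fun v => f v * g v).
Proof.
apply: dfun2; exists (Par 0), (Mul (Par 1) (Par 2)) => v.
by split=> [|[]//]; exists v.
Qed.

Lemma dfun_succ f : dfun f -> dfun (fun v => (f v).+1).
Proof.
apply: dfun1; exists (Par 0), (Add (Par 1) (Cst 1)) => v.
by split=> [/= ->|[w /= ->]]; [exists v | ]; rewrite /= addn1.
Qed.

Lemma dfun_peval F G e : (forall i, dfun (F i)) -> (forall i, dfun (G i)) ->
  dfun (fun v => peval (F^~ v) (G^~ v) e).
Proof.
move=> dF dG; elim: e => [c|i|i|a da b db|a da b db] /=.
- exact: dfun_cst.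
- exact: dF.
- exact: dG.
- exact: dfun_add.
exact: dfun_mul.
Qed.

Lemma dioph_eq f g : dfun f -> dfun g -> dioph (fun v => f v = g v).
Proof.
apply: (dioph2 (R := fun x y => x = y)); exists (Par 0), (Par 1) => v.
by split=> [|[]//]; exists v.
Qed.

Lemma dioph_comp R f : dfun f -> dioph (fun v => R (v 0) (shift v)) ->
  dioph (fun v => R (f v) v).
Proof.
move=> df dR; apply: (@dioph_subst (scons f (fun i v => v i))) dR => -[] //=.
exact: dfun_var.
Qed.

Ltac dio_fun := first
  [ assumption | apply: dfun_var | apply: dfun_cst | apply: dfun_succ
  | apply: dfun_add | apply: dfun_mul ].
Ltac dio_rel := first
  [ assumption | apply: dioph_and | apply: dioph_or | apply: dioph_ex
  | apply: dioph_eq ].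
Ltac dio := repeat lazymatch goal with
  | |- dfun _ => dio_fun
  | |- dioph _ => dio_rel
  end.

Lemma dioph_leq f g : dfun f -> dfun g -> dioph (fun v => f v <= g v).
Proof.
apply: (dioph2 (R := fun x y => is_true (x <= y))).
apply: (@dioph_iff (fun v => exists x, v 0 + x = v 1)); last by dio.
by move=> v; split=> [[x <-]|]; [rewrite leq_addr | exists (v 1 - v 0); lia].
Qed.

Lemma dioph_dvdn f g : dfun f -> dfun g -> dioph (fun v => f v %| g v).
Proof.
apply: (dioph2 (R := fun x y => is_true (x %| y))).
apply: (@dioph_iff (fun v => exists x, v 1 = x * v 0)); last by dio.
by move=> v; split=> [[x ->]|/dvdnP//]; rewrite dvdn_mull.
Qed.

Ltac dio_rel ::= first
  [ assumption | apply: dioph_and | apply: dioph_or | apply: dioph_ex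
  | apply: dioph_eq | apply: dioph_leq | apply: dioph_dvdn ].

(** * The exponential is Diophantine *)

Section Alpha.
Import Order.TTheory GRing.Theory Num.Theory.
Local Open Scope ring_scope.

(* alpha b n = (l^n - l^-n) / (l - l^-1), where l + l^-1 = b. *)
Definition alpha (b : int) (n : nat) : int :=
  (iter n (fun p => (p.2, b * p.2 - p.1)) (0 : int, 1 : int)).1.

Lemma alpha0 b : alpha b 0 = 0. Proof. by []. Qed.
Lemma alpha1 b : alpha b 1 = 1. Proof. by []. Qed.
Lemma alphaSS b n : alpha b n.+2 = b * alpha b n.+1 - alpha b n.
Proof. by []. Qed.

Lemma nat_ind2 (P : nat -> Prop) :
  P 0%N -> P 1%N -> (forall n, P n -> P n.+1 -> P n.+2) -> forall n, P n.
Proof.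
move=> P0 P1 PSS n; suff: P n /\ P n.+1 by case.
by elim: n => [|n [Pn PSn]]; split=> //; exact: PSS.
Qed.

Lemma alpha_norm b n :
  alpha b n.+1 * alpha b n.+1 + alpha b n * alpha b n =
  b * alpha b n.+1 * alpha b n + 1.
Proof.
by elim: n => [|n IHn]; [rewrite alpha0 alpha1 | rewrite alphaSS]; nia.
Qed.

Lemma alphaD b m n :
  alpha b (m + n).+1 = alpha b m.+1 * alpha b n.+1 - alpha b m * alpha b n.
Proof.
elim/nat_ind2: n => [||n IH0 IH1]; first by rewrite addn0 alpha1 alpha0; ring.
  by rewrite addn1 alphaSS alphaSS alpha1 alpha0; ring.
by rewrite addnS in IH1; rewrite !addnS alphaSS IH1 IH0 !alphaSS; ring.
Qed.

Lemma alpha_grow b n : 2 <= b -> 0 <= alpha b n < alpha b n.+1.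
Proof.
move=> b2; elim: n => [|n IHn]; first by rewrite alpha0 alpha1.
by rewrite alphaSS; nia.
Qed.

Lemma alpha_ge0 b n : 2 <= b -> 0 <= alpha b n.
Proof. by move=> /(alpha_grow n)/andP[]. Qed.

Lemma alpha_mono b m n : 2 <= b -> (m <= n)%N -> alpha b m <= alpha b n.
Proof.
move=> b2 /subnK <-; elim: (n - m)%N => [|k IHk]; first by rewrite add0n.
by rewrite addSn; have := alpha_grow (k + m) b2; lia.
Qed.

Lemma alpha_ltn b m n : 2 <= b -> (m < n)%N -> alpha b m < alpha b n.
Proof.
move=> b2 lt_mn; have := alpha_mono b2 lt_mn; have := alpha_grow m b2; lia.
Qed.

Lemma alpha_ge b n : 2 <= b -> n%:Z <= alpha b n.
Proof.
by move=> b2; elim: n => // n IHn; have := alpha_grow n b2; lia.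
Qed.

Lemma alpha_pow b n : 2 <= b -> (b - 1) ^+ n <= alpha b n.+1.
Proof.
move=> b2; elim: n => [|n IHn]; first by rewrite expr0 alpha1.
rewrite exprS alphaSS; have := alpha_grow n b2; nia.
Qed.

Lemma alpha_base_mono b w n : 2 <= b -> b <= w -> alpha b n <= alpha w n.
Proof.
move=> b2 bw.
suff: 0 <= alpha w n - alpha b n <= alpha w n.+1 - alpha b n.+1 by lia.
elim: n => [|n IHn]; first by rewrite !alpha0 !alpha1.
rewrite !alphaSS; have := alpha_ge0 n.+1 b2; nia.
Qed.

(** Descent: running the recurrence backwards turns (x, y) into (b x - y, x), again a solution with
    a smaller first entry, until x = 0 and y = 1. *)
Lemma alpha_complete (b x y : nat) : (1 < b)%N -> (x <= y)%N ->
  (x * x + y * y = b * x * y + 1)%N ->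
  exists n, x%:Z = alpha b n /\ y%:Z = alpha b n.+1.
Proof.
move=> b2; elim/ltn_ind: x y => x IHx y le_xy E.
have [x0|x0] := eqVneq x 0%N; last first.
  have le_y : (y <= b * x)%N by nia.
  have [|||n [En ESn]] := IHx (b * x - y)%N _ x; [nia..|].
  by exists n.+1; rewrite -ESn alphaSS -ESn -En; split=> //; lia.
by exists 0%N; rewrite alpha0 alpha1 x0; split=> //; nia.
Qed.

Lemma alpha_sol (b x y : nat) : (1 < b)%N ->
  (x * x + y * y = b * x * y + 1)%N -> exists n, x%:Z = alpha b n.
Proof.
move=> b2 E; case: (leqP x y) => [le_xy|/ltnW le_yx].
  by have [n [En _]] := alpha_complete b2 le_xy E; exists n.
have E' : (y * y + x * x = b * y * x + 1)%N by lia.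
by have [n [_ En]] := alpha_complete b2 le_yx E'; exists n.+1.
Qed.

Lemma alpha_coprime b n : coprimez (alpha b n.+1) (alpha b n).
Proof.
apply/coprimezP; exists (alpha b n.+1 - b * alpha b n, alpha b n) => /=.
by have := alpha_norm b n; lia.
Qed.

Lemma alpha_dvdD b k n : (0 < k)%N ->
  (alpha b k %| alpha b (n + k))%Z = (alpha b k %| alpha b n)%Z.
Proof.
case: k => // k _; rewrite addnS alphaD rpredBl; last exact: dvdz_mull.
by rewrite Gauss_dvdzl // alpha_coprime.
Qed.

(** Adding k to the index preserves divisibility by [alpha b k], so m may be reduced modulo k; a
    nonzero remainder would give a positive term smaller than its divisor. *)
Lemma alpha_dvd b k m : 2 <= b -> (0 < k)%N ->
  (alpha b k %| alpha b m)%Z -> (k %| m)%N.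
Proof.
move=> b2 k0; rewrite {1}(divn_eq m k).
elim: (m %/ k)%N => [|q IHq]; last first.
  by rewrite mulSn -addnA addnC alpha_dvdD.
rewrite mul0n add0n; have := ltn_pmod m k0; rewrite /dvdn.
case: (m %% k)%N => // r lt_rk.
have := alpha_ltn b2 lt_rk; have := alpha_ltn (m := 0) b2 (ltn0Sn r).
rewrite alpha0 => pos lt /dvdzP[q E]; exfalso.
by case: (lerP q 0) => q0; nia.
Qed.

(* Expansion of [alpha b (l * k)] to second order in [alpha b k]. *)
Lemma alpha_mul b k l : exists p q r : int,
  [/\ alpha b (l * k.+1) = p * alpha b k.+1,
      alpha b (l * k.+1).+1 = alpha b k.+2 ^+ l + q * alpha b k.+1
    & p * alpha b k.+2 = l%:Z * alpha b k.+2 ^+ l + r * alpha b k.+1].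
Proof.
set A := alpha b k.+1; set B := alpha b k.+2.
elim: l => [|l [p [q [r [E1 E2 E3]]]]].
  by exists 0, 0, 0; rewrite mul0n alpha0 alpha1 expr0; split; ring.
exists (B ^+ l + q * A + p * B - b * p * A), (q * B - p * A).
exists (q * B + r * B - b * p * B).
have Ak : alpha b k = b * A - B by rewrite /B alphaSS /A; ring.
rewrite mulSn addnC; split.
- by rewrite addnS alphaD E1 E2 -/A Ak; ring.
- by rewrite alphaD E1 E2 -/A -/B exprS; ring.
have -> : (B ^+ l + q * A + p * B - b * p * A) * B =
  (B ^+ l + q * A - b * p * A) * B + p * B * B by ring.
by rewrite E3 exprS intS; ring.
Qed.

(** Let A and B be the terms of indices k + 1 and k + 2. By [alpha_mul] the term of index l (k + 1)
    is p A with p B = l B^l modulo A, and B is prime to A; hence A divides p exactly when it divides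
    l. Divisibility between values thus becomes divisibility of an index by a value. *)
Lemma alpha_sqr_dvd b k l : 2 <= b ->
  (alpha b k.+1 ^+ 2 %| alpha b (l * k.+1))%Z = (alpha b k.+1 %| l%:Z)%Z.
Proof.
move=> b2; have [p [q [r [-> _ E]]]] := alpha_mul b k l.
have A0 : alpha b k.+1 != 0 by have := alpha_grow k b2; lia.
rewrite expr2 dvdz_mul2r //.
have cop : coprimez (alpha b k.+1) (alpha b k.+2).
  by rewrite coprimez_sym alpha_coprime.
rewrite -(Gauss_dvdzl _ cop) E rpredDr; last exact: dvdz_mull.
by rewrite Gauss_dvdzl // coprimezXr.
Qed.

Lemma alpha_mod b w v n : (v %| w - b)%Z -> (v %| alpha w n - alpha b n)%Z.
Proof.
move=> /dvdzP[k E]; have {E}-> : w = b + k * v by lia.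
elim/nat_ind2: n => [||n IH0 IH1].
- by rewrite !alpha0 subrr dvdz0.
- by rewrite !alpha1 subrr dvdz0.
rewrite !alphaSS.
set x := alpha _ n.+1 in IH1 *; set y := alpha _ n in IH0 *.
have -> : (b + k * v) * x - y - (b * alpha b n.+1 - alpha b n) =
  b * (x - alpha b n.+1) - (y - alpha b n) + k * x * v by ring.
apply: rpredD; last exact/dvdz_mull/dvdzz.
by apply: rpredB => //; exact: dvdz_mull.
Qed.

Lemma alpha_2 n : alpha 2 n = n%:Z.
Proof. by elim/nat_ind2: n => // n E0 E1; rewrite alphaSS E0 E1; lia. Qed.

(** In base 2 the sequence is the identity, so a base congruent to 2 modulo u reveals the index
    modulo u. *)
Lemma alpha_mod2 w u n : (u %| w - 2)%Z -> (u %| alpha w n - n%:Z)%Z.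
Proof. by move=> /(alpha_mod n); rewrite alpha_2. Qed.

(** The modulus identifies the two neighbours of index m + 1, and the recurrence reads the same in
    both directions; so the sequence is symmetric about m + 1. *)
Lemma alpha_reflect b m j : (j <= m.+1)%N ->
  (alpha b m.+2 - alpha b m %| alpha b (m.+1 + j) - alpha b (m.+1 - j))%Z.
Proof.
set v := alpha b m.+2 - alpha b m; elim/nat_ind2: j => [||j IH0 IH1] lej.
- by rewrite addn0 subn0 subrr.
- by rewrite addn1 subn1.
have -> : alpha b (m.+1 + j.+2) - alpha b (m.+1 - j.+2) =
   b * (alpha b (m.+1 + j.+1) - alpha b (m.+1 - j.+1)) -
   (alpha b (m.+1 + j) - alpha b (m.+1 - j)).
  have -> : (m.+1 - j = (m.+1 - j.+2).+2)%N by lia.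
  have -> : (m.+1 - j.+1 = (m.+1 - j.+2).+1)%N by lia.
  by rewrite !addnS !alphaSS; ring.
by apply: rpredB; [apply/dvdz_mull/IH1 | apply: IH0]; lia.
Qed.

(** The reflection about m + 1 combines with the oddness of the sequence about 0 into a sign change
    under translation by 2 (m + 1). *)
Lemma alpha_antiperiod b m j :
  (alpha b m.+2 - alpha b m %| alpha b (m.+1.*2 + j) + alpha b j)%Z.
Proof.
set v := alpha b m.+2 - alpha b m; elim/nat_ind2: j => [||j IH0 IH1].
- have := alpha_reflect b (leqnn m.+1).
  by rewrite subnn alpha0 subr0 addnn addn0 addr0.
- have H0 := alpha_reflect b (leqnn m.+1).
  have H1 := alpha_reflect b (leqnSn m).
  rewrite subnn alpha0 subr0 in H0; rewrite subSnn alpha1 in H1.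
  have -> : (m.+1.*2 + 1 = (m.+1 + m).+2)%N by lia.
  rewrite addnS in H0; rewrite alphaSS alpha1.
  set x := alpha _ (_ + _).+1 in H0 *; set y := alpha _ _ in H1 *.
  have -> : b * x - y + 1 = b * x - (y - 1) by ring.
  by apply: rpredB => //; exact: dvdz_mull.
have -> : alpha b (m.+1.*2 + j.+2) + alpha b j.+2 =
   b * (alpha b (m.+1.*2 + j.+1) + alpha b j.+1)
   - (alpha b (m.+1.*2 + j) + alpha b j) by rewrite !addnS !alphaSS; ring.
by apply: rpredB => //; exact: dvdz_mull.
Qed.

(* Modulo [alpha (m + 2) - alpha m], every index n may be replaced by one of
   absolute value at most m + 1. *)
Lemma alpha_fold b m n : exists2 j : nat, (j <= m.+1)%N &
  exists2 s : int,
    (alpha b m.+2 - alpha b m %| alpha b n - s * alpha b j)%Z &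
    exists2 t : int, (m.+1%:Z %| n%:Z - t * j%:Z)%Z
      & s ^+ 2 = 1 /\ t ^+ 2 = 1.
Proof.
rewrite (divn_eq n m.+1.*2); elim: (n %/ _)%N => [|q]; last first.
  rewrite mulSn -addnA; set i := (_ + _ %% _)%N.
  move=> [j lej [s Ds [t Dt [s2 t2]]]].
  exists j => //; exists (- s).
    have := rpredB (alpha_antiperiod b m i) Ds.
    rewrite -/(_ %| _)%Z; congr (_ %| _)%Z; ring.
  exists t; last by rewrite sqrrN.
  rewrite PoszD -addrA rpredDl // -muln2 PoszM; exact: dvdz_mulr.
rewrite mul0n add0n; set i := (_ %% _)%N.
have lti : (i < m.+1.*2)%N by rewrite ltn_mod double_gt0.
case: (leqP i m.+1) => [lei|gti].
  exists i => //; exists 1; first by rewrite mul1r subrr dvdz0.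
  by exists 1; rewrite ?mul1r ?subrr // expr1n.
exists (m.+1.*2 - i)%N; first by lia.
exists 1; first last.
  exists (-1); last by [].
  by apply/dvdzP; exists 2; lia.
have lej : (i - m.+1 <= m.+1)%N by lia.
have := alpha_reflect b lej; rewrite mul1r.
have -> : (m.+1 + (i - m.+1) = i)%N by lia.
by have -> : (m.+1 - (i - m.+1) = m.+1.*2 - i)%N by lia.
Qed.

Lemma dvdz_small (v z : int) : (v %| z)%Z -> `|z| < v -> z = 0.
Proof.
move=> /dvdzP[q ->]; case: (ltrgtP q 0) => [q0|q0|->]; last by rewrite mul0r.
  by nia.
by nia.
Qed.

Lemma dvdz_sign (v s : int) (x y : nat) : s ^+ 2 = 1 ->
  (v %| x%:Z - s * y%:Z)%Z -> (x%:Z + y%:Z < v) -> x = y.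
Proof.
move=> s2 dv lt.
have /orP[/eqP Es|/eqP Es] : (s == 1) || (s == -1) by rewrite -sqrf_eq1 s2.
  by have := dvdz_small dv; rewrite Es => H; have := H ltac:(lia); lia.
by have := dvdz_small dv; rewrite Es => H; have := H ltac:(lia); lia.
Qed.

Definition alphaN (b n : nat) : nat := `|alpha b%:Z n|%N.

Lemma alphaNE (b n : nat) : (1 < b)%N -> (alphaN b n)%:Z = alpha b n.
Proof. by move=> b2; rewrite /alphaN gez0_abs // alpha_ge0. Qed.

Lemma alphaN_norm (b n : nat) : (1 < b)%N ->
  (alphaN b n * alphaN b n + alphaN b n.+1 * alphaN b n.+1 =
   b * alphaN b n * alphaN b n.+1 + 1)%N.
Proof.
move=> b2; have := alpha_norm b n; rewrite -!alphaNE //; lia.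
Qed.

Lemma alphaN_odd (b n : nat) : (1 < b)%N ->
  odd (alphaN b n) || odd (alphaN b n.+1).
Proof.
move=> /(alphaN_norm n) /(congr1 odd); rewrite !oddD !oddM.
by case: (odd b) (odd _) (odd (alphaN b n.+1)) => [] [] [].
Qed.

(* Matiyasevich's system: x is a term of the sequence in base w, which is
   congruent to the one in base b modulo v and to the identity modulo u. *)
Definition alpha_sys (b a c : nat) : Prop :=
  exists u t s r v w x y k1 k2 k3 k4 : nat,
  ((u * u + t * t = b * u * t + 1) /\
   (r * r + s * s = b * r * s + 1 /\ r < s /\ (u * u %| s)%N /\
    v + 2 * r = b * s) /\
   (w = b + k1 * v /\ w = 2 + k2 * u) /\
   (x * x + y * y = w * x * y + 1) /\
   (x = a + k3 * v /\ x = c + k4 * u) /\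
   (2 * a < u /\ 2 * c < u))%N.

(** Here u and s are terms of base b, and u^2 | s makes u divide the index n + 1 of s. If x is the
    term of index i in base w, then [alpha_fold] gives j <= n + 1 with a = +-[alpha b j] modulo v
    and j = +-i modulo n + 1, hence c = +-j modulo u. The bounds 2 a < u and 2 c < u, with v > 2 s
    from b >= 4, turn both congruences into equalities. *)
Lemma alpha_sound (b a c : nat) : (3 < b)%N -> alpha_sys b a c ->
  a = alphaN b c.
Proof.
move=> b4 [u [t [s [r [v [w [x [y [k1 [k2 [k3 [k4]]]]]]]]]]]].
move=> [Eu [[Er [lt_rs [dv_us Ev]]] [[Ew1 Ew2] [Ex [[Ex1 Ex2] [lta ltc]]]]]].
have b2 : 2 <= b%:Z by lia.
have b1 : (1 < b)%N by lia.
have [[|k] Ek] := alpha_sol b1 Eu; first by move: Ek; rewrite alpha0; lia.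
have [n [En ESn]] := alpha_complete b1 (ltnW lt_rs) Er.
have w1 : (1 < w)%N by lia.
have [i Ei] := alpha_sol w1 Ex.
have dvn : (u%:Z %| n.+1%:Z)%Z.
  have dv2 : (alpha b k.+1 ^+ 2 %| alpha b n.+1)%Z.
    by rewrite -ESn -Ek expr2 -PoszM dvdzE.
  have /dvdnP[l El] : (k.+1 %| n.+1)%N.
    by apply: (@alpha_dvd b) => //; apply: dvdz_trans dv2; rewrite dvdz_exp.
  move: dv2; rewrite El alpha_sqr_dvd // -Ek => dv.
  by rewrite PoszM dvdz_mulr.
have Evv : alpha b n.+2 - alpha b n = v%:Z by rewrite alphaSS -ESn -En; lia.
have [j lej [s0 Ds [t0 Dt [s2 t2]]]] := alpha_fold b n i.
rewrite Evv in Ds.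
have dvx : (v%:Z %| x%:Z - alpha b i)%Z.
  rewrite Ei; apply: alpha_mod; rewrite Ew1 PoszD addrC addKr PoszM.
  exact/dvdz_mull/dvdzz.
have dux : (u%:Z %| x%:Z - i%:Z)%Z.
  rewrite Ei; apply: alpha_mod2; rewrite Ew2 PoszD addrC addKr PoszM.
  exact/dvdz_mull/dvdzz.
have le_us : (u <= s)%N.
  apply: leq_trans (dvdn_leq (leq_ltn_trans _ lt_rs) dv_us) => //.
  by apply: leq_pmulr; apply: leq_ltn_trans lta.
have le_js : alpha b j <= s by rewrite ESn alpha_mono.
have Ea : a = alphaN b j.
  apply: (@dvdz_sign v s0) => //; last first.
    have le_4s : (4 * s <= b * s)%N by rewrite leq_mul2r b4 orbT.
    by rewrite alphaNE //; move: lt_rs Ev lta le_us le_js le_4s; clear; lia.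
  rewrite alphaNE //.
  have -> : a%:Z - s0 * alpha b j = (alpha b i - s0 * alpha b j) +
     (x%:Z - alpha b i) - k3%:Z * v%:Z by rewrite Ex1 PoszD PoszM; ring.
  apply: rpredB; last exact/dvdz_mull/dvdzz.
  exact: rpredD.
suff -> : c = j by [].
apply: (@dvdz_sign u t0) => //; last first.
  have := alpha_ge j b2; rewrite -alphaNE // -Ea.
  by move: lta ltc; clear; lia.
have -> : c%:Z - t0 * j%:Z = (i%:Z - t0 * j%:Z) + (x%:Z - i%:Z) - k4%:Z * u%:Z.
  by rewrite Ex2 PoszD PoszM; ring.
apply: rpredB; last exact/dvdz_mull/dvdzz.
by apply: rpredD => //; apply: dvdz_trans dvn Dt.
Qed.

Lemma dvdz_subP (d m n : nat) : (n <= m)%N -> (d%:Z %| m%:Z - n%:Z)%Z ->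
  exists k, (m = n + k * d)%N.
Proof.
move=> le_nm; rewrite subzn // dvdzE => /dvdnP[k E].
by exists k; rewrite -E subnKC.
Qed.

Lemma eqn_mod_dvdz (d m n : nat) :
  (m = n %[mod d])%N -> (d%:Z %| m%:Z - n%:Z)%Z.
Proof. by move=> E; rewrite -eqz_mod_dvd !modz_nat E. Qed.

Lemma alpha_sys_complete (b c : nat) : (3 < b)%N -> alpha_sys b (alphaN b c) c.
Proof.
move=> b4; have b1 : (1 < b)%N by lia.
have b2 : 2 <= b%:Z by lia.
set a := alphaN b c.
(* One of two consecutive terms is odd. The oddness of u will make u and v coprime: a common divisor
   divides 2 r and s, where s is prime to r, hence divides 2. *)
have [k [k0 odd_k]] : exists k, (2 * a + 2 * c < k)%N /\ odd (alphaN b k).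
  have /orP[] := alphaN_odd (2 * a + 2 * c).+1 b1 => Ok.
    by exists (2 * a + 2 * c).+1.
  by exists (2 * a + 2 * c).+2.
set u := alphaN b k in odd_k *.
have le_ku : (k <= u)%N by have := alpha_ge k b2; rewrite -alphaNE //.
case: k => // k in k0 u odd_k le_ku *.
(* With u the term of index k + 1, the index u (k + 1) makes u^2 divide s, by [alpha_sqr_dvd] with l
   = u. *)
have [n En] : exists n, n.+1 = (u * k.+1)%N by exists (u * k.+1).-1; nia.
set s := alphaN b n.+1; set r := alphaN b n.
have lt_rs : (r < s)%N by have := alpha_grow n b2; rewrite -!alphaNE //; lia.
have [v Ev] : exists v, (v + 2 * r = b * s)%N by exists (b * s - 2 * r)%N; nia.
have dv_us : (u * u %| s)%N.
  have := alpha_sqr_dvd k u b2; rewrite -En -!alphaNE // dvdzz.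
  by rewrite expr2 -PoszM dvdzE.
have cop_sr : coprime s r.
  by have := alpha_coprime b n; rewrite -!alphaNE.
have cop : coprime v u.
  have d_u : (gcdn v u %| u)%N by exact: dvdn_gcdr.
  have d_s : (gcdn v u %| s)%N.
    by apply: dvdn_trans dv_us; apply: dvdn_mulr.
  have : (gcdn v u %| 2 * r)%N.
    by rewrite -(dvdn_addr _ (dvdn_gcdl v u)) Ev dvdn_mull.
  rewrite Gauss_dvdl; last by apply: coprime_dvdl d_s _.
  move=> /[dup] /dvdn_leq - /(_ isT); rewrite /coprime.
  case: (gcdn v u) d_u => [|[|[]]] // d_u.
  by move: odd_k; rewrite -[odd u]negbK -dvdn2 d_u.
(* The added multiple of u v keeps both congruences and makes w exceed b, so that the quotients k1,
   ..., k4 are natural numbers. *)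
pose w := (chinese v u b 2 + b.+1 * u * v)%N.
have wv : (w = b %[mod v])%N by rewrite /w addnC modnMDl chinese_modl.
have wu : (w = 2 %[mod u])%N by rewrite /w mulnAC addnC modnMDl chinese_modr.
have v0 : (0 < v)%N.
  by move: Ev lt_rs b4 => Ev lt_rs b4; clear -Ev lt_rs b4; nia.
have u0 : (0 < u)%N by apply: leq_trans le_ku.
have wb : (b.+1 <= w)%N.
  by apply: leq_trans (leq_addl _ _); rewrite -mulnA leq_pmulr // muln_gt0 u0.
have [k1 Ek1] := dvdz_subP (ltnW wb) (eqn_mod_dvdz wv).
have w1 : (1 < w)%N by apply: leq_trans wb; apply: leqW.
have [k2 Ek2] := dvdz_subP w1 (eqn_mod_dvdz wu).
have w2 : 2 <= w%:Z by [].
have [||k3 Ek3] := @dvdz_subP v (alphaN w c) a.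
- by rewrite -lez_nat !alphaNE // alpha_base_mono //; apply: ltnW wb.
- by rewrite !alphaNE //; apply/alpha_mod/eqn_mod_dvdz.
have [||k4 Ek4] := @dvdz_subP u (alphaN w c) c.
- by rewrite -lez_nat !alphaNE // alpha_ge.
- by rewrite !alphaNE //; apply/alpha_mod2/eqn_mod_dvdz.
exists u, (alphaN b k.+2), s, r, v, w, (alphaN w c), (alphaN w c.+1).
exists k1, k2, k3, k4.
rewrite !alphaN_norm //; do !split=> //.
- by move: k0 le_ku; clear; lia.
- by move: k0 le_ku; clear; lia.
Qed.
End Alpha.

Lemma alpha_sysP (b a c : nat) : 3 < b -> a = alphaN b c <-> alpha_sys b a c.
Proof.
move=> b4; split=> [->|]; [exact: alpha_sys_complete | exact: alpha_sound].
Qed.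

Lemma dioph_alpha_sys f g h : dfun f -> dfun g -> dfun h ->
  dioph (fun v => alpha_sys (f v) (g v) (h v)).
Proof. by apply: dioph3; rewrite /alpha_sys /shift; dio. Qed.

(** * Powers as residues of the sequence *)

Section PowAlpha.
Import Order.TTheory GRing.Theory Num.Theory.
Local Open Scope ring_scope.

(* Modulo b q - q^2 - 1, q is a root of x^2 - b x + 1. *)
Lemma pow_alpha (b q : int) n :
  (b * q - q * q - 1 %| q ^+ n - (alpha b n.+1 - (b - q) * alpha b n))%Z.
Proof.
elim: n => [|n /(dvdz_mull q) IHn].
  by rewrite alpha0 alpha1 expr0 mulr0 subr0 subrr dvdz0.
have -> : q ^+ n.+1 - (alpha b n.+2 - (b - q) * alpha b n.+1) =
  q * (q ^+ n - (alpha b n.+1 - (b - q) * alpha b n)) -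
  alpha b n * (b * q - q * q - 1) by rewrite exprS alphaSS; ring.
apply: rpredB => //; exact/dvdz_mull/dvdzz.
Qed.

Lemma dvdz_subP2 (d m n : nat) : (d%:Z %| m%:Z - n%:Z)%Z ->
  exists k l, (m + k * d = n + l * d)%N.
Proof.
case: (leqP n m) => [le|/ltnW le] D.
  by have [k ->] := dvdz_subP le D; exists 0%N, k; rewrite mul0n addn0.
rewrite -opprB rpredN in D.
by have [k ->] := dvdz_subP le D; exists k, 0%N; rewrite mul0n addn0.
Qed.

Lemma PoszX (m n : nat) : (m ^ n)%N%:Z = m%:Z ^+ n.
Proof. by elim: n => // n IHn; rewrite expnS exprS PoszM IHn. Qed.

(** p is the residue of B - (b - q) A modulo M = b q - q^2 - 1, where A and B are the terms n and n
    + 1 in base b; k and l express the congruence without subtraction. The number b0 is there to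
    make M exceed q^n: it is at least (q + 3)^n. The 4 keeps its base in the range of
    [alpha_sysP]. *)
Definition pow_sys (p q n : nat) : Prop :=
  exists b0 b A B M k l : nat,
  (alpha_sys (q + 4) b0 n.+1 /\ b = b0 + q * q + 2 /\ alpha_sys b A n /\
  alpha_sys b B n.+1 /\ M + q * q + 1 = b * q /\ p < M /\
  p + b * A + k * M = B + q * A + l * M)%N.

Lemma pow_alphaN (b q n M : nat) : (1 < b)%N -> (M + q * q + 1 = b * q)%N ->
  (M%:Z %| (q ^ n + b * alphaN b n)%N%:Z -
           (alphaN b n.+1 + q * alphaN b n)%N%:Z)%Z.
Proof.
move=> b1 EM; have := pow_alpha b q n.
have -> : b%:Z * q%:Z - q%:Z * q%:Z - 1 = M%:Z by lia.
rewrite !PoszD !PoszM !alphaNE // PoszX; congr (_ %| _)%Z; ring.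
Qed.

Lemma pow_bound (p q B : nat) : (0 < q)%N -> (p <= B)%N ->
  (p + q * q + 1 < (B + q * q + 2) * q)%N.
Proof. by move=> q0 le_pB; nia. Qed.

Lemma pow_sysP p q n : (0 < q)%N -> p = (q ^ n)%N <-> pow_sys p q n.
Proof.
move=> q0; pose b0 := alphaN (q + 4) n.+1; pose b := (b0 + q * q + 2)%N.
have Q4 : (3 < q + 4)%N by lia.
have b4 : (3 < b)%N.
  have : (n.+1 <= b0)%N by rewrite -lez_nat alphaNE ?alpha_ge //; lia.
  rewrite /b; nia.
have b1 : (1 < b)%N by exact: ltnW (ltnW b4).
have le_pow : (q ^ n <= b0)%N.
  rewrite -lez_nat alphaNE; last by lia.
  apply: le_trans (alpha_pow _ _); last by lia.
  rewrite PoszX lerXn2r // ?nnegrE; lia.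
have ltM : (q ^ n + q * q + 1 < b * q)%N.
  exact: pow_bound.
have D := pow_alphaN n b1.
split=> [->|].
  have [M EM] : exists M, (M + q * q + 1 = b * q)%N.
    by exists (b * q - (q * q + 1))%N; rewrite -addnA subnK //; lia.
  have [k [l E]] := dvdz_subP2 (D _ _ EM).
  exists b0, b, (alphaN b n), (alphaN b n.+1), M, k, l.
  rewrite -!alpha_sysP //; do !split=> //; lia.
move=> [b0' [b' [A [B [M [k [l]]]]]]].
rewrite -alpha_sysP // => -[-> [->]]; rewrite -!alpha_sysP // => -[-> [->]].
rewrite -/b0 -/b => -[EM [ltpM E]]; have := D _ _ EM => DM.
suff : p%:Z - (q ^ n)%:Z = 0 by lia.
apply: (@dvdz_small M); last by move: ltpM ltM EM; clear; lia.
have -> : p%:Z - (q ^ n)%:Z = (l%:Z - k%:Z) * M%:Z -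
  ((q ^ n + b * alphaN b n)%N%:Z - (alphaN b n.+1 + q * alphaN b n)%N%:Z).
  by rewrite mulrBl -!PoszM; move: E; clear; lia.
by apply: rpredB => //; exact/dvdz_mull/dvdzz.
Qed.
End PowAlpha.

Lemma dfun_pow f g : dfun f -> dfun g -> dfun (fun v => f v ^ g v).
Proof.
apply: dfun2; apply: (@dioph_iff (fun v =>
  (v 1 = 0 /\ v 2 = 0 /\ v 0 = 1) \/ (v 1 = 0 /\ 0 < v 2 /\ v 0 = 0) \/
  (0 < v 1 /\ pow_sys (v 0) (v 1) (v 2)))) => [v|]; last first.
  rewrite /pow_sys /shift; dio; apply: dioph_alpha_sys; dio.
case: (posnP (v 1)) => [->|v1].
  case: (posnP (v 2)) => [->|v2]; first by rewrite expn0; lia.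
  by rewrite exp0n //; intuition.
rewrite pow_sysP //; split=> [[|[]]|]; [lia|lia|by case|by right;right].
Qed.

(** * Quotients, binomial coefficients and factorials *)

Lemma dfun_divn f g : dfun f -> dfun g -> dfun (fun v => f v %/ g v).
Proof.
apply: dfun2; apply: (@dioph_iff (fun v => (v 2 = 0 /\ v 0 = 0) \/
  (v 0 * v 2 <= v 1 /\ v 1 < (v 0).+1 * v 2))) => [v|]; last by dio.
case: (posnP (v 2)) => [->|v2]; first by rewrite divn0; lia.
split=> [[|[H1 H2]]|->]; first by lia.
  apply/eqP; rewrite eqn_leq leq_divRL // H1 /=.
  by rewrite -ltnS ltn_divLR.
by right; rewrite leq_divM ltn_ceil.
Qed.

Lemma dfun_modn f g : dfun f -> dfun g -> dfun (fun v => f v %% g v).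
Proof.
apply: dfun2; apply: (@dioph_iff (fun v => (v 1 = v 1 %/ v 2 * v 2 + v 0)))
  => [v|]; last by dio; apply: dfun_divn; dio.
by rewrite {1}(divn_eq (v 1) (v 2)); lia.
Qed.

Lemma digit_sum u N (d : nat -> nat) k : (forall i, d i < u) -> k < N ->
  (\sum_(i < N) d i * u ^ i) %/ u ^ k %% u = d k.
Proof.
elim: N d k => // N IHN d k lt_du; have u0 := leq_ltn_trans (leq0n _) (lt_du 0).
rewrite big_ord_recl expn0 muln1.
under eq_bigr => i _ do rewrite /bump /= expnS mulnCA.
rewrite -big_distrr /=; case: k => [|k] ltkN.
  by rewrite expn0 divn1 mulnC addnC modnMDl modn_small.
rewrite expnS divnMA addnC [u * _]mulnC divnMDl // (divn_small (lt_du 0)) addn0.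
by rewrite (IHN (fun i => d i.+1)).
Qed.

Lemma digit_sum_lt u N (d : nat -> nat) : (forall i, d i < u) ->
  \sum_(i < N) d i * u ^ i < u ^ N.
Proof.
move=> lt_du; elim: N => [|N IHN]; first by rewrite big_ord0.
rewrite big_ord_recr /= expnS; apply: leq_trans (_ : (d N).+1 * u ^ N <= _).
  by rewrite mulSn ltn_add2r.
by rewrite leq_mul2r lt_du orbT.
Qed.

(** In base u = 2^n + 1 the digits of (u + 1)^n are the binomial coefficients, each being at most
    2^n. *)
Lemma bin_digit n k :
  'C(n, k) = ((2 ^ n).+2 ^ n %/ (2 ^ n).+1 ^ k) %% (2 ^ n).+1.
Proof.
set u := (2 ^ n).+1; have lt_bin i : 'C(n, i) < u.
  rewrite ltnS; case: (leqP i n) => [le_in|/bin_small->//].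
  rewrite -[2]/(1 + 1) expnDn (bigD1 (Ordinal (le_in : i < n.+1))) //=.
  by rewrite !exp1n !muln1 leq_addr.
rewrite -addn1 -/u addnC expnDn.
under eq_bigr => i _ do rewrite exp1n mul1n.
case: (leqP k n) => [le_kn|lt_nk]; first by rewrite digit_sum.
rewrite bin_small // divn_small ?mod0n //.
apply: leq_trans (digit_sum_lt n.+1 lt_bin) _.
by rewrite leq_pexp2l.
Qed.

Lemma dfun_bin f g : dfun f -> dfun g -> dfun (fun v => 'C(f v, g v)).
Proof.
move=> df dg; apply: (@dioph_iff (fun v => v 0 =
  ((2 ^ f (shift v)).+2 ^ f (shift v) %/ (2 ^ f (shift v)).+1 ^ g (shift v))
     %% (2 ^ f (shift v)).+1)) => [v|]; first by rewrite bin_digit.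
by dio; do ?[apply: dfun_modn | apply: dfun_divn | apply: dfun_pow
  | apply: dfun_succ | apply: dfun_cst | exact: dfun_shift].
Qed.

Lemma ffact_leq r n : r ^_ n <= r ^ n.
Proof.
elim: n => // n IHn; rewrite ffactnSr expnSr.
by apply: leq_mul => //; exact: leq_subr.
Qed.

(** The estimate r (r - 1) ... (r - n + 1) >= r^n (1 - n^2 / r), multiplied by r. *)
Lemma ffact_lower r n : n <= r -> r * r ^ n <= r * r ^_ n + n * n * r ^ n.
Proof.
elim: n => [|n IHn] lt_nr; first by rewrite leq_addr.
have := IHn (ltnW lt_nr); rewrite ffactnSr expnS.
have := ffact_leq r n.
have [s ->] : exists s, r = s + n by exists (r - n); rewrite subnK // ltnW.
rewrite addnK; move: (_ ^_ n) (_ ^ n) => F P; clear; nia.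
Qed.

(** The exact quotient is n! times r^n over the falling factorial: at least n!, and less than n! + 1
    once r is large, by [ffact_lower]. *)
Lemma factorial_divn n r : (n`!).+1 * (n * n) < r -> n`! = r ^ n %/ 'C(r, n).
Proof.
move=> lt_r; have le_nr : n <= r by nia.
have C0 : 0 < 'C(r, n) by rewrite bin_gt0.
have Eff := bin_ffact r n; have low := ffact_lower le_nr.
have up := ffact_leq r n.
have P0 : 0 < r ^ n by rewrite expn_gt0; lia.
have E : n`!.+1 * 'C(r, n) = 'C(r, n) + r ^_ n by rewrite mulSn mulnC Eff.
apply/eqP; rewrite eqn_leq leq_divRL // mulnC Eff up /= -ltnS ltn_divLR // E.
rewrite ltnNge; apply/negP => leP.
have H1 : n`!.+1 * (r * r ^_ n) <= n`! * (r * r ^ n).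
  have -> : n`!.+1 * (r * r ^_ n) = n`! * r * ('C(r, n) + r ^_ n).
    by rewrite -Eff; lia.
  by rewrite mulnA leq_mul2l leP orbT.
have H2 : n`!.+1 * (n * n) * r ^ n < r * r ^ n by rewrite ltn_pmul2r.
have := leq_mul (leqnn n`!.+1) low; move: H1 H2; clear.
by rewrite mulnDr mulnA -mulnA; lia.
Qed.

Lemma dfun_fact f : dfun f -> dfun (fun v => (f v)`!).
Proof.
(* The bound on r must not mention n!, so n^n >= n! replaces it. *)
apply: dfun1; apply: (@dioph_iff (fun v => v 0 =
  ((v 1 ^ v 1).+1 * (v 1 * v 1)).+1 ^ v 1
    %/ 'C(((v 1 ^ v 1).+1 * (v 1 * v 1)).+1, v 1))) => [v|].
  rewrite -factorial_divn // ltnS leq_mul2r; apply/orP; right.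
  by rewrite -ffactnn ltnS ffact_leq.
by dio; apply: dfun_divn; [apply: dfun_pow|apply: dfun_bin]; dio;
   apply: dfun_pow; dio.
Qed.

(** * Bounded universal quantifiers *)

Lemma coprime_primes m n : 0 < m ->
  (forall p, prime p -> p %| m -> p %| n -> False) -> coprime m n.
Proof.
move=> m0 H; rewrite /coprime; have g0 : 0 < gcdn m n by rewrite gcdn_gt0 m0.
case: (ltngtP (gcdn m n) 1) => // [|g1]; first by rewrite ltnNge g0.
have [dm dn] := (dvdn_gcdl m n, dvdn_gcdr m n).
by case: (H _ (pdiv_prime g1)); apply: dvdn_trans (pdiv_dvd _) _.
Qed.

Lemma prime_dvd_prod (p n : nat) (F : nat -> nat) : prime p ->
  p %| \prod_(i < n) F i -> exists2 i, i < n & p %| F i.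
Proof.
move=> pr_p; elim: n => [|n IHn]; first by rewrite big_ord0 Euclid_dvd1.
rewrite big_ord_recr /= Euclid_dvdM // => /orP[/IHn[i lti]|]; last by exists n.
by exists i => //; apply: ltnW.
Qed.

Lemma prime_dvd_fact p n : prime p -> p %| n`! -> p <= n.
Proof.
move=> pr_p; elim: n => [|n IHn]; first by rewrite Euclid_dvd1.
by rewrite factS Euclid_dvdM // => /orP[/dvdn_leq->|/IHn/leqW].
Qed.

Definition pairwise_coprime (m : nat -> nat) n :=
  forall i j, i < j -> j < n -> coprime (m i) (m j).

Lemma coprime_prod_r x (m : nat -> nat) n :
  (forall i, i < n -> coprime x (m i)) -> coprime x (\prod_(i < n) m i).
Proof.
elim: n => [|n IHn] cop; first by rewrite big_ord0 coprimen1.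
rewrite big_ord_recr coprimeMr cop // IHn // => i lti; apply: cop.
exact: ltnW.
Qed.

Lemma eq_mod_prod (m : nat -> nat) n x y : pairwise_coprime m n ->
  (forall i, i < n -> x = y %[mod m i]) -> x = y %[mod \prod_(i < n) m i].
Proof.
elim: n => [|n IHn] cop E; first by rewrite big_ord0 !modn1.
rewrite big_ord_recr /=; apply/eqP; rewrite chinese_remainder; last first.
  by rewrite coprime_sym coprime_prod_r // => i lti; rewrite coprime_sym cop.
apply/andP; split; apply/eqP; last exact: E.
by apply: IHn => [i j ltij ltj|i lti]; [apply: cop | apply: E] => //;
   apply: ltnW.
Qed.

Lemma chinese_seq (m r : nat -> nat) n : pairwise_coprime m n ->
  exists a, forall i, i < n -> a = r i %[mod m i].
Proof.
elim: n => [|n IHn] cop; first by exists 0.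
have [|a Ea] := IHn.
  by move=> i j ltij ltj; apply: cop => //; apply: ltnW.
have cop_n : coprime (\prod_(i < n) m i) (m n).
  by rewrite coprime_sym coprime_prod_r // => i lti; rewrite coprime_sym cop.
exists (chinese (\prod_(i < n) m i) (m n) a (r n)) => i.
rewrite ltnS leq_eqVlt => /predU1P[->|lti]; first exact: chinese_modr.
rewrite -Ea // -(modn_dvdm (m := \prod_(i < n) m i)).
  by rewrite chinese_modl // modn_dvdm // (bigD1 (Ordinal lti)) //= dvdn_mulr.
by rewrite (bigD1 (Ordinal lti)) //= dvdn_mulr.
Qed.

Lemma peval_mod d v v' w w' e :
  (forall i, v i = v' i %[mod d]) ->
  (forall i, i < pbound e -> w i = w' i %[mod d]) ->
  peval v w e = peval v' w' e %[mod d].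
Proof.
move=> Ev; elim: e => //= [i Hw|a IHa b IHb Hw|a IHa b IHb Hw]; first exact: Hw.
  by rewrite -modnDm IHa ?IHb ?modnDm // => i lti; apply: Hw;
     rewrite leq_max lti ?orbT.
by rewrite -modnMm IHa ?IHb ?modnMm // => i lti; apply: Hw;
   rewrite leq_max lti ?orbT.
Qed.

Lemma peval_leq v v' w w' e :
  (forall i, v i <= v' i) -> (forall i, i < pbound e -> w i <= w' i) ->
  peval v w e <= peval v' w' e.
Proof.
move=> Ev; elim: e => //= [i Hw|a IHa b IHb Hw|a IHa b IHb Hw]; first exact: Hw.
  by apply: leq_add; [apply: IHa | apply: IHb] => i lti; apply: Hw;
     rewrite leq_max lti ?orbT.
by apply: leq_mul; [apply: IHa | apply: IHb] => i lti; apply: Hw;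
   rewrite leq_max lti ?orbT.
Qed.

Section Moduli.
Variables (n Q : nat).
Hypothesis lt_nQ : n < Q.
(** The square is needed so that T / (i + 1) is still a multiple of Q!; every prime p <= Q then
    divides T / (i + 1) and not [modulus i]. *)
Let T := Q`! * Q`!.

Definition modulus (i : nat) := (T %/ i.+1).+1.

Lemma modulus_mul i : i < n -> i.+1 * modulus i = T + i.+1.
Proof.
move=> lti; rewrite /modulus mulnS addnC mulnC divnK //.
by apply/dvdn_mull/dvdn_fact; lia.
Qed.

Lemma modulus_prime i p : i < n -> prime p -> p %| modulus i -> Q < p.
Proof.
move=> lti pr_p; rewrite ltnNge => dv; apply/negP => le_pQ.
have dvF : p %| T %/ i.+1.
  rewrite /T -muln_divA; last by apply: dvdn_fact; lia.
  by apply/dvdn_mulr/dvdn_fact; rewrite prime_gt0.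
by move: dv; rewrite /modulus -addn1 dvdn_addr // Euclid_dvd1.
Qed.

Lemma modulus_coprime : pairwise_coprime modulus n.
Proof.
move=> i j ltij ltjn; have ltin := ltn_trans ltij ltjn.
apply: coprime_primes => // p pr_p dvi dvj.
have := modulus_prime ltin pr_p dvi; apply/negP; rewrite -leqNgt.
have : p %| (T + j.+1) - (T + i.+1).
  by rewrite -!modulus_mul // dvdn_sub // dvdn_mull.
rewrite subnDl => /dvdn_leq le_p; have := le_p _; lia.
Qed.

(** Since (i + 1) [modulus i] = T + i + 1, the product of variable length is (T + 1) ... (T + n) /
    n!, a single binomial coefficient and hence Diophantine. *)
Lemma modulus_prod : \prod_(i < n) modulus i = 'C(T + n, n).
Proof.
apply/eqP; rewrite -(eqn_pmul2r (fact_gt0 n)) bin_ffact.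
suff H k : k <= n -> (\prod_(i < k) modulus i) * k`! = (T + k) ^_ k.
  by rewrite H.
elim: k => [|k IHk] ltk; first by rewrite big_ord0 ffactn0.
rewrite big_ord_recr /= factS addnS ffactSS -IHk ?(ltnW ltk) // -addnS.
by rewrite -(modulus_mul ltk) mulnACA (mulnC _ k.+1) [RHS]mulnACA.
Qed.
End Moduli.

Lemma eq_mod_compl d T c y : d %| c + T + 1 -> d %| T + y.+1 -> c = y %[mod d].
Proof.
move=> dc dy; apply/eqP; rewrite -(eqn_modDr (T + 1)) addnA (eqP dc).
by rewrite addnCA addn1 (eqP dy).
Qed.

(* The residues of a modulo the factors of M code the witnesses of all y < n:
   a prime divisor p > Q of [modulus Q y] divides M, hence -T-1 is y modulo p,
   M %| 'C(a j, u.+1) makes the residue of a j at most u, and the bound Q turns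
   the congruence modulo p into an equality. *)
Definition ball_code (e1 e2 : pexp) (v : env) (n : nat) (a : env)
    (u Q c : nat) : Prop :=
  let M := 'C(Q`! * Q`! + n, n) in
  [/\ peval (scons n v) (fun=> u) e1 + peval (scons n v) (fun=> u) e2
        + n + u < Q,
      M %| c + Q`! * Q`! + 1,
      forall j, j < maxn (pbound e1) (pbound e2) -> M %| 'C(a j, u.+1)
    & peval (scons c v) a e1 %% M = peval (scons c v) a e2 %% M].

Lemma ball_sound e1 e2 v n a u Q c : ball_code e1 e2 v n a u Q c ->
  forall y, y < n ->
  exists w, peval (scons y v) w e1 = peval (scons y v) w e2.
Proof.
move=> [ltQ dvc dva E] y lty.
have lt_nQ : n < Q by move: ltQ; clear; lia.
have lt_uQ : u < Q by move: ltQ; clear; lia.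
have m1 : 1 < modulus Q y.
  by rewrite /modulus ltnS divn_gt0 // dvdn_leq ?muln_gt0 ?fact_gt0 //
     dvdn_mulr // dvdn_fact //=; lia.
pose p := pdiv (modulus Q y); have pr_p : prime p by apply: pdiv_prime.
have dvm : p %| modulus Q y by apply: pdiv_dvd.
have lt_Qp : Q < p by apply: (modulus_prime lt_nQ lty).
have dvM : p %| 'C(Q`! * Q`! + n, n).
  by rewrite -modulus_prod // (bigD1 (Ordinal lty)) //= dvdn_mulr.
have Ec : y = c %[mod p].
  apply/esym/(eq_mod_compl (dvdn_trans dvM dvc)).
  by rewrite -(modulus_mul lt_nQ) // dvdn_mull.
pose w j := a j %% p; exists w.
have le_wu j : j < maxn (pbound e1) (pbound e2) -> w j <= u.
  move=> ltj; have {ltj}/(dvdn_trans dvM) := dva j ltj; rewrite /w.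
  case: (ltnP u (a j)) => [lt_ua|le_au _]; last first.
    exact: leq_trans (leq_mod _ _) le_au.
  move=> /(dvdn_mulr u.+1`!); rewrite bin_ffact ffact_prod.
  move=> /(prime_dvd_prod (F := fun i => a j - i) pr_p)[i ltiu].
  have le_ia : i <= a j by apply: leq_trans lt_ua; apply: ltnW.
  rewrite -eqn_mod_dvd // => /eqP->; rewrite modn_small //.
  by move: ltiu lt_uQ lt_Qp; clear; lia.
have small e : pbound e <= maxn (pbound e1) (pbound e2) ->
    peval (scons n v) (fun=> u) e < p -> peval (scons y v) w e < p.
  move=> le_e; apply: leq_ltn_trans; apply: peval_leq => [[|i]|i lti] //=.
    exact: ltnW.
  by apply: le_wu; apply: leq_trans le_e.
have cong e : peval (scons y v) w e = peval (scons c v) a e %[mod p].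
  by apply: peval_mod => [[|i]|i lti] //=; rewrite modn_mod.
rewrite -[LHS](modn_small (small _ (leq_maxl _ _) _)); last first.
  by move: ltQ lt_Qp; clear; lia.
rewrite -[RHS](modn_small (small _ (leq_maxr _ _) _)); last first.
  by move: ltQ lt_Qp; clear; lia.
by rewrite !cong -(modn_dvdm _ dvM) E modn_dvdm.
Qed.

Lemma ball_complete e1 e2 v n :
  (forall y, y < n ->
     exists w, peval (scons y v) w e1 = peval (scons y v) w e2) ->
  exists a u Q c, ball_code e1 e2 v n a u Q c.
Proof.
move=> Hy; have /choice[w Ew] : forall y, exists w, y < n ->
    peval (scons y v) w e1 = peval (scons y v) w e2.
  by move=> y; case: (ltnP y n) => [/Hy[w]|]; [exists w | exists v].
pose K := maxn (pbound e1) (pbound e2).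
pose u := \max_(y < n) \max_(j < K) w y j.
have le_wu y j : y < n -> j < K -> w y j <= u.
  move=> lty ltj; apply: leq_trans (leq_bigmax (Ordinal lty)) => /=.
  exact: leq_trans (leq_bigmax (Ordinal ltj)).
pose Q := (peval (scons n v) (fun=> u) e1 + peval (scons n v) (fun=> u) e2
  + n + u).+1.
have lt_nQ : n < Q by rewrite /Q; lia.
have lt_uQ : u < Q by rewrite /Q; lia.
pose T := Q`! * Q`!; have cop := modulus_coprime lt_nQ.
have /choice[a Ea] : forall j, exists a, forall y, y < n ->
    a = w y j %[mod modulus Q y].
  by move=> j; apply: chinese_seq cop.
pose M := 'C(T + n, n).
have M0 : 0 < M by rewrite bin_gt0 leq_addl.
have dvM y : y < n -> modulus Q y %| M.
  move=> lty; rewrite /M -modulus_prod // (bigD1 (Ordinal lty)) //=.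
  exact: dvdn_mulr.
(* The last witness is (T + 1) (M - 1), a natural number congruent to -T - 1 modulo M. *)
exists a, u, Q, (T.+1 * M - T.+1); split=> // [|j ltj|]; rewrite -/T -/M.
- by rewrite -addnA addn1 subnK ?dvdn_mull // leq_pmulr.
- rewrite /dvdn -[X in _ == X](mod0n M) /M -modulus_prod //.
  apply/eqP/eq_mod_prod => // y lty; rewrite mod0n; apply/eqP.
  (* The prime factors of the modulus exceed Q > u, so (u + 1)! may be multiplied in. The binomial
     coefficient becomes a (a - 1) ... (a - u), which contains the factor a - w divisible by the
     modulus. *)
  rewrite -/(_ %| _) -(@Gauss_dvdl _ _ u.+1`!); last first.
    apply: coprime_primes => // p pr_p dvp /(prime_dvd_fact pr_p) le_p.
    have := modulus_prime lt_nQ lty pr_p dvp; lia.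
  rewrite bin_ffact; case: (ltnP u (a j)) => [lt_ua|le_au]; last first.
    by rewrite ffact_small.
  have lt_wu : w y j < u.+1 by rewrite ltnS le_wu.
  rewrite ffact_prod (bigD1 (Ordinal lt_wu)) //= dvdn_mulr //.
  rewrite -eqn_mod_dvd ?Ea //; apply: leq_trans (ltnW lt_ua).
  exact: lt_wu.
have EM : M = \prod_(i < n) modulus Q i by rewrite modulus_prod.
rewrite [X in _ %% X = _]EM [X in _ = _ %% X]EM.
apply: eq_mod_prod => // y lty.
have cong e : peval (scons (T.+1 * M - T.+1) v) a e =
    peval (scons y v) (w y) e %[mod modulus Q y].
  apply: peval_mod => [[|i]|i lti] //=; last exact: Ea.
  apply: (@eq_mod_compl _ T).
    2: by rewrite -(modulus_mul lt_nQ) // dvdn_mull.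
  rewrite -addnA addn1 subnK ?leq_pmulr //.
  exact: dvdn_mull (dvM y lty).
by rewrite !cong Ew.
Qed.

Lemma dfun_peval_scons h V G e :
  dfun h -> (forall i, dfun (V i)) -> (forall i, dfun (G i)) ->
  dfun (fun v => peval (scons (h v) (V^~ v)) (G^~ v) e).
Proof.
move=> dh dV dG; have := @dfun_peval (scons h V) G e.
have -> : (fun v => peval ((scons h V)^~ v) (G^~ v) e) =
    (fun v => peval (scons (h v) (V^~ v)) (G^~ v) e).
  by apply/funext => v; congr peval; apply/funext => -[].
by apply=> // -[].
Qed.

Lemma dioph_ball_code e1 e2 V n A u Q c :
  (forall i, dfun (V i)) -> (forall i, dfun (A i)) ->
  dfun n -> dfun u -> dfun Q -> dfun c ->
  dioph (fun v => ball_code e1 e2 (V^~ v) (n v) (A^~ v) (u v) (Q v) (c v)).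
Proof.
move=> dV dA dn du dQ dc.
have dT := dfun_mul (dfun_fact dQ) (dfun_fact dQ).
have dM := dfun_bin (dfun_add dT dn) dn.
apply: (dioph_iff (S := fun v =>
  (peval (scons (n v) (V^~ v)) (fun=> u v) e1
     + peval (scons (n v) (V^~ v)) (fun=> u v) e2 + n v + u v < Q v /\
   'C((Q v)`! * (Q v)`! + n v, n v) %| c v + (Q v)`! * (Q v)`! + 1) /\
  ((forall j, j < maxn (pbound e1) (pbound e2) ->
     'C((Q v)`! * (Q v)`! + n v, n v) %| 'C(A j v, (u v).+1)) /\
   peval (scons (c v) (V^~ v)) (A^~ v) e1 %%
     'C((Q v)`! * (Q v)`! + n v, n v) =
   peval (scons (c v) (V^~ v)) (A^~ v) e2 %%
     'C((Q v)`! * (Q v)`! + n v, n v)))) => [v|].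
  by split=> [[[? ?] [? ?]]|[]].
dio; do ?[exact: dfun_peval_scons | apply: dfun_fact => //
  | apply: dfun_modn => //].
by apply: dioph_all => j _; dio; apply: dfun_bin; dio.
Qed.

Lemma dioph_ball S f : dfun f -> dioph (fun v => S (v 0) (shift v)) ->
  dioph (fun v => forall y, y < f v -> S y v).
Proof.
move=> df [e1 [e2 He]].
apply: (dioph_comp (R := fun n v => forall y, y < n -> S y v)) df _.
apply: (@dioph_iff (fun v => exists a u Q c,
    ball_code e1 e2 (shift v) (v 0) a u Q c)) => [v|].
  split=> [[a [u [Q [c /ball_sound Hy]]]] y /Hy Ey|Hy].
    exact/(He (scons y (shift v))).
  apply: ball_complete => y lty.
  exact/(He (scons y (shift v)))/Hy.
apply: dioph_exfun; dio.
(* After the four quantifiers, c, Q and u sit at 0, 1 and 2, the witness environment at 2 i + 3 and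
   the original one at 2 i + 4. *)
apply: (@dioph_ball_code _ _
  (fun i v => v i.+1.*2.+4) _ (fun i v => v i.*2.+3));
  by move=> *; apply: dfun_var.
Qed.

(** * Certificates of computations *)

Lemma cpair_inj a b c d : cpair a b = cpair c d -> a = c /\ b = d.
Proof.
by move=> /(congr1 Cantor.of_nat); rewrite !Cantor.cancel_of_to => -[].
Qed.

Lemma cpair_surj n : exists a b, n = cpair a b.
Proof.
rewrite -(Cantor.cancel_to_of n); case: (Cantor.of_nat n) => a b.
by exists a, b.
Qed.

Lemma cpairE a b : cpair a b * 2 = b * 2 + (b + a) * (b + a).+1.
Proof. exact: Cantor.to_nat_spec. Qed.

Ltac cpair_simpl := repeat match goal with
  | H : cpair _ _ = cpair _ _ |- _ => case: (cpair_inj H) => {H} *; subst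
  | H : _.+1 = _.+1 |- _ => case: H => H; subst
  end; try discriminate.

Lemma computes_det f n r :
  computes f n r -> forall r', computes f n r' -> r = r'.
Proof.
elim=> {f n r}.
- by move=> n r'; inversion 1.
- by move=> n r'; inversion 1.
- by move=> a b r'; inversion 1; cpair_simpl.
- by move=> a b r'; inversion 1; cpair_simpl.
- by move=> f g n a b _ IHf _ IHg r'; inversion 1; subst; congr cpair; auto.
- move=> f g n a b _ IHg _ IHf r'; inversion 1; subst; apply: IHf.
  by have -> : a = a0 by exact: IHg.
- move=> f g a r _ IHf r'; move Em: (cpair a 0) => m cm.
  by inversion cm; subst; cpair_simpl; apply: IHf.
- move=> f g a n r s _ IHr _ IHg r'; move Em: (cpair a n.+1) => m cm.
  inversion cm; subst; cpair_simpl; apply: IHg.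
  match goal with H : computes (PR_rec f g) _ ?q |- _ =>
    by have -> : r = q by exact: IHr
  end.
move=> f a k v _ IH0 _ IHv r'; inversion 1; subst.
case: (ltngtP k r') => // lt.
  match goal with H : _ |- _ => by have := IH0 _ (H k lt) end.
match goal with
H : computes f (cpair a r') 0 |- _ => by have := IHv _ lt _ H end.
Qed.

Fixpoint code (f : partrec) : nat :=
  match f with
  | PR_zero => cpair 0 0
  | PR_succ => cpair 1 0
  | PR_fst => cpair 2 0
  | PR_snd => cpair 3 0
  | PR_pair f g => cpair 4 (cpair (code f) (code g))
  | PR_comp f g => cpair 5 (cpair (code f) (code g))
  | PR_rec f g => cpair 6 (cpair (code f) (code g))
  | PR_min f => cpair 7 (code f)
  end.

Definition triple e n r := cpair e (cpair n r).

(* [justified D e n r]: the clause of [computes] for the program coded by e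
   yields the value r at n, given the triples in D. *)
Definition justified (D : nat -> nat -> nat -> Prop) (e n r : nat) : Prop :=
  (e = cpair 0 0 /\ r = 0) \/
  (e = cpair 1 0 /\ r = n.+1) \/
  (e = cpair 2 0 /\ exists b, n = cpair r b) \/
  (e = cpair 3 0 /\ exists a, n = cpair a r) \/
  (exists f g a b, e = cpair 4 (cpair f g) /\ D f n a /\ D g n b /\
     r = cpair a b) \/
  (exists f g a, e = cpair 5 (cpair f g) /\ D g n a /\ D f a r) \/
  (exists f g a, e = cpair 6 (cpair f g) /\ n = cpair a 0 /\ D f a r) \/
  (exists f g a m q, e = cpair 6 (cpair f g) /\ n = cpair a m.+1 /\
     D e (cpair a m) q /\ D g (cpair a (cpair m q)) r) \/
  (exists f, e = cpair 7 f /\ D f (cpair n r) 0 /\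
     forall i, i < r -> exists v, D f (cpair n i) v.+1).

Lemma justified_mono (D D' : nat -> nat -> nat -> Prop) e n r :
  (forall e n r, D e n r -> D' e n r) ->
  justified D e n r -> justified D' e n r.
Proof.
move=> sDD'; rewrite /justified => -[?|H]; [by left|right].
case: H => [?|H]; [by left|right].
case: H => [?|H]; [by left|right].
case: H => [?|H]; [by left|right].
case: H => [[f [g [a [b [E [Df [Dg Er]]]]]]]|H]; [left|right].
  by exists f, g, a, b; do ?split; auto.
case: H => [[f [g [a [E [Df Dg]]]]]|H]; [left|right].
  by exists f, g, a; do ?split; auto.
case: H => [[f [g [a [E [En Df]]]]]|H]; [left|right].
  by exists f, g, a; do ?split; auto.
case: H => [[f [g [a [m [q [E [En [Df Dg]]]]]]]]|[f [E [Df Dv]]]]; [left|right].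
  by exists f, g, a, m, q; do ?split; auto.
exists f; do ?split; auto.
by move=> i /Dv[v ?]; exists v; auto.
Qed.

Lemma justified_sound (D : nat -> nat -> nat -> Prop) f n r :
  (forall g m s, D (code g) m s -> computes g m s) ->
  justified D (code f) n r -> computes f n r.
Proof.
move=> sound; rewrite /justified.
case=> [[E ->]|]; first by case: f E => //= *; cpair_simpl; constructor.
case=> [[E ->]|]; first by case: f E => //= *; cpair_simpl; constructor.
case=> [[E [b ->]]|]; first by case: f E => //= *; cpair_simpl; constructor.
case=> [[E [b ->]]|]; first by case: f E => //= *; cpair_simpl; constructor.
case=> [[cf [cg [a [b [E [Df [Dg ->]]]]]]]|].
  by case: f E => //= *; cpair_simpl; constructor; apply: sound.
case=> [[cf [cg [a [E [Dg Df]]]]]|].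
  by case: f E => //= *; cpair_simpl; apply: C_comp; apply: sound; eassumption.
case=> [[cf [cg [a [E [-> Df]]]]]|].
  by case: f E => //= *; cpair_simpl; constructor; apply: sound.
case=> [[cf [cg [a [m [q [E [-> [Df Dg]]]]]]]]|[cf [E [Df Dv]]]].
  case: f E Df => //= *; cpair_simpl; apply: C_recS; last exact: sound Dg.
  exact: (sound (PR_rec _ _)).
case: f E Df Dv => //= [*|*|*|*|*|*|*|g]; cpair_simpl => E Df Dv; cpair_simpl.
have /choice[v Hv] : forall i, exists v, i < r -> computes g (cpair n i) v.+1.
  move=> i; case: (ltnP i r) => [/Dv[v]|]; last by exists 0.
  by exists v => _; apply: sound.
by apply: (@C_min _ _ _ v) => [|i /Hv//]; apply: sound.
Qed.

Definition certificate (s : nat -> nat) (L : nat) : Prop :=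
  forall i, i < L -> exists e n r, s i = triple e n r /\
    justified (fun e n r => exists j, j < i /\ s j = triple e n r) e n r.

Lemma triple_inj e n r e' n' r' :
  triple e n r = triple e' n' r' -> [/\ e = e', n = n' & r = r'].
Proof. by move=> /cpair_inj[-> /cpair_inj[-> ->]]. Qed.

(** Strong induction on the position. A certificate may also contain triples whose first entry codes
    no program; nothing is claimed about these, and a triple for a genuine code relies only on
    genuine subcodes. *)
Lemma certificate_sound s L : certificate s L ->
  forall i f n r, i < L -> s i = triple (code f) n r -> computes f n r.
Proof.
move=> cert; elim/ltn_ind => i IHi f n r ltiL Ei.
have [e [n' [r' [E J]]]] := cert i ltiL.
have [Ee En Er] := triple_inj (etrans (esym Ei) E).
rewrite -{}Ee -{}En -{}Er in J; apply: justified_sound J => g m q [j [ltji Ej]].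
exact: IHi ltji _ _ _ (ltn_trans ltji ltiL) Ej.
Qed.

Definition list_certificate (l : seq nat) := certificate (nth 0 l) (size l).

Lemma list_certificate_cat l1 l2 :
  list_certificate l1 -> list_certificate l2 -> list_certificate (l1 ++ l2).
Proof.
move=> c1 c2 i; rewrite size_cat nth_cat; case: (ltnP i (size l1)) => lti.
  have [e [n [r [E J]]]] := c1 i lti => _; exists e, n, r; split=> //.
  apply: justified_mono J => e' n' r' [j [ltji Ej]]; exists j.
  by rewrite nth_cat (ltn_trans ltji lti).
move=> ltiL; have [|e [n [r [E J]]]] := c2 (i - size l1); first by lia.
exists e, n, r; split=> //.
apply: justified_mono J => e' n' r' [j [ltji Ej]]; exists (size l1 + j).
by rewrite nth_cat [_ < size l1]ltnNge leq_addr addKn; split=> //; lia.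
Qed.

Lemma list_certificate_rcons l e n r : list_certificate l ->
  justified (fun e n r => triple e n r \in l) e n r ->
  list_certificate (rcons l (triple e n r)).
Proof.
move=> cl J i; rewrite size_rcons ltnS leq_eqVlt nth_rcons => /predU1P[->|lti].
  rewrite ltnn eqxx; exists e, n, r; split=> //.
  apply: justified_mono J => e' n' r' /(nthP 0)[j ltj Ej]; exists j.
  by rewrite nth_rcons ltj.
rewrite lti; have [e' [n' [r' [E J']]]] := cl i lti; exists e', n', r'.
split=> //; apply: justified_mono J' => e0 n0 r0 [j [ltji Ej]]; exists j.
by rewrite nth_rcons (ltn_trans ltji lti).
Qed.

Definition provable e n r :=
  exists2 l, list_certificate l & triple e n r \in l.

Lemma provable_justified e n r :
  (exists2 l, list_certificate l &
     justified (fun e n r => triple e n r \in l) e n r) -> provable e n r.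
Proof.
move=> [l cl J]; exists (rcons l (triple e n r)).
  exact: list_certificate_rcons.
by rewrite mem_rcons mem_head.
Qed.

Lemma provable2 e n r e' n' r' : provable e n r -> provable e' n' r' ->
  exists2 l, list_certificate l & triple e n r \in l /\ triple e' n' r' \in l.
Proof.
move=> [l1 c1 H1] [l2 c2 H2]; exists (l1 ++ l2).
  exact: list_certificate_cat.
by rewrite !mem_cat H1 H2 orbT.
Qed.

Lemma computes_provable f n r : computes f n r -> provable (code f) n r.
Proof.
elim=> {f n r} /=.
- move=> n; apply: provable_justified; exists [::] => //.
  by left.
- move=> n; apply: provable_justified; exists [::] => //.
  by right; left.
- move=> a b; apply: provable_justified; exists [::] => //.
  by do 2 right; left; split=> //; exists b.
- move=> a b; apply: provable_justified; exists [::] => //.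
  by do 3 right; left; split=> //; exists a.
- move=> f g n a b _ IHf _ IHg; have [l cl [Hf Hg]] := provable2 IHf IHg.
  apply: provable_justified; exists l => //.
  by do 4 right; left; exists (code f), (code g), a, b.
- move=> f g n a b _ IHg _ IHf; have [l cl [Hg Hf]] := provable2 IHg IHf.
  apply: provable_justified; exists l => //.
  by do 5 right; left; exists (code f), (code g), a.
- move=> f g a r _ [l cl Hf].
  apply: provable_justified; exists l => //.
  by do 6 right; left; exists (code f), (code g), a.
- move=> f g a n r s _ IHf _ IHg; have [l cl [Hf Hg]] := provable2 IHf IHg.
  apply: provable_justified; exists l => //.
  by do 7 right; left; exists (code f), (code g), a, n, r.
move=> f a k v _ [l cl Hk] _ IHv.
have [l' cl' Hl'] : exists2 l, list_certificate l &
    forall i, i < k -> triple (code f) (cpair a i) (v i).+1 \in l.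
  elim: k IHv {Hk} => [|k IHk] Hv; first by exists [::].
  have [i lti|l1 c1 H1] := IHk; first by apply: Hv; apply: ltnW.
  have [l2 c2 H2] := Hv k (ltnSn k).
  exists (l1 ++ l2) => [|i]; first exact: list_certificate_cat.
  rewrite ltnS leq_eqVlt mem_cat => /predU1P[->|/H1->//].
  by rewrite H2 orbT.
apply: provable_justified; exists (l ++ l'); first exact: list_certificate_cat.
do 8 right; exists (code f); split=> //; split; first by rewrite mem_cat Hk.
by move=> i lti; exists (v i); rewrite mem_cat Hl' ?orbT.
Qed.

Lemma provableP f n r : provable (code f) n r <-> computes f n r.
Proof.
split=> [[l cl /(nthP 0)[i lti Ei]]|]; last exact: computes_provable.
exact: certificate_sound cl _ _ _ _ lti Ei.
Qed.

Definition digit N b i := N %/ b ^ i %% b.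

(** A list is coded as the digits of N in a base b above all its entries, so three numbers replace
    the list. *)
Lemma provable_digit e n r : provable e n r <->
  exists N b L, certificate (digit N b) L /\
    exists i, i < L /\ digit N b i = triple e n r.
Proof.
have eq_cert s s' L : (forall i, i < L -> s i = s' i) ->
    certificate s L -> certificate s' L.
  move=> E cs i lti; have [e' [n' [r' [Ei J]]]] := cs i lti.
  exists e', n', r'; rewrite -E //; split=> //.
  apply: justified_mono J => ? ? ? [j [ltji Ej]]; exists j.
  by rewrite -E // (ltn_trans ltji lti).
split=> [[l cl /(nthP 0)[i lti Ei]]|[N [b [L [cert [i [lti Ei]]]]]]].
  pose b := (\max_(x <- l) x).+1.
  pose N := \sum_(i < size l) nth 0 l i * b ^ i.
  have ltb j : nth 0 l j < b.
    case: (ltnP j (size l)) => [ltj|le]; last by rewrite nth_default.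
    by rewrite ltnS; apply: leq_bigmax_seq => //; apply: mem_nth.
  have dE j : j < size l -> nth 0 l j = digit N b j.
    by move=> ltj; rewrite /digit digit_sum.
  exists N, b, (size l); split; first exact: eq_cert dE cl.
  by exists i; rewrite -dE.
exists [seq digit N b i | i <- iota 0 L]; last first.
  by rewrite -Ei; apply: map_f; rewrite mem_iota.
rewrite /list_certificate size_map size_iota; apply: eq_cert cert => j ltj.
by rewrite (nth_map 0) ?size_iota // nth_iota.
Qed.

Lemma dfun_cpair f g : dfun f -> dfun g -> dfun (fun v => cpair (f v) (g v)).
Proof.
apply: dfun2; apply: (@dioph_iff (fun v =>
  v 0 * 2 = v 2 * 2 + (v 2 + v 1) * (v 2 + v 1).+1)) => [v|]; last by dio.
by rewrite -cpairE; split=> [/eqP|->//]; rewrite eqn_mul2r => /eqP.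
Qed.

Lemma dfun_digit f g h : dfun f -> dfun g -> dfun h ->
  dfun (fun v => digit (f v) (g v) (h v)).
Proof.
by move=> *; apply: dfun_modn => //; apply: dfun_divn => //; apply: dfun_pow.
Qed.

Ltac dio_fun ::= first
  [ assumption | apply: dfun_var | apply: dfun_cpair | apply: dfun_digit
  | apply: dfun_cst | apply: dfun_succ | apply: dfun_add | apply: dfun_mul ].

(** The universal quantifiers run over the positions below L and, for minimisation, over the
    arguments below r; both are bounded, and all others are existential. *)
Lemma dioph_provable f g h : dfun f -> dfun g -> dfun h ->
  dioph (fun v => provable (f v) (g v) (h v)).
Proof.
apply: dioph3; apply: dioph_iff (fun v => iff_sym (provable_digit _ _ _)) _.
rewrite /certificate /justified /triple.
do ?[progress dio | apply: dioph_ball].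
Qed.

(** * Diagonalisation *)

Definition diagonal (n : nat) : Prop := provable n n 0.

Lemma dioph_diagonal : dioph (fun v => diagonal (v 0)).
Proof. by apply: dioph_provable; dio. Qed.

Definition computable (F : nat -> nat) : Prop :=
  exists f, forall n, computes f n (F n).

(** A decider composed with the instance map is a program h. At its own code it outputs 1 if that
    code is diagonal, which means output 0, and outputs 0 if it is not, which makes it diagonal. *)
Lemma diagonal_undecidable (T : Type) (enc : T -> nat) (yes : T -> Prop)
    (inst : nat -> T) :
  computable (enc \o inst) -> (forall n, yes (inst n) <-> diagonal n) ->
  ~ decidable_problem enc yes.
Proof.
move=> [g Hg] yesE [f Hf]; pose h := PR_comp f g; pose e := code h.
have run b : computes f (enc (inst e)) b -> computes h e b.
  by move=> cf; apply: C_comp cf; apply: Hg.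
have [Hyes Hno] := Hf (inst e).
have [Ke|nKe] := pselect (diagonal e).
  have c1 := run _ (Hyes (proj2 (yesE e) Ke)).
  by have := computes_det c1 (proj1 (provableP _ _ _) Ke).
apply: (nKe); apply/provableP/run/Hno => y; apply: nKe; exact/yesE.
Qed.

(** * Sums of four squares *)

Section FourSquares.
Import Order.TTheory GRing.Theory Num.Theory.
Local Open Scope ring_scope.

Definition sum4sq (n : int) : Prop :=
  exists a b c d : int, n = a * a + b * b + c * c + d * d.

(** Euler's identity, the multiplicativity of the quaternion norm. *)
Lemma sum4sqM m n : sum4sq m -> sum4sq n -> sum4sq (m * n).
Proof.
move=> [a [b [c [d ->]]]] [x [y [z [t ->]]]].
exists (a * x + b * y + c * z + d * t), (a * y - b * x + c * t - d * z).
exists (a * z - c * x + d * y - b * t), (a * t - d * x + b * z - c * y).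
by ring.
Qed.

Lemma round_div (x m : int) : 0 < m ->
  exists k y, x = y + k * m /\ - m <= 2 * y <= m.
Proof.
move=> m0; have m_neq0 : m != 0 by rewrite gt_eqF.
have := modz_ge0 x m_neq0; have := ltz_pmod x m0; have := divz_eq x m.
move: (x %/ m)%Z (x %% m)%Z => q r E ltr ger.
case: (lerP (2 * r) m) => le_r; first by exists q, r; lia.
by exists (q + 1), (r - m); lia.
Qed.

Lemma sum4_eq0 (a b c d : int) :
  0 = a * a + b * b + c * c + d * d -> a = 0.
Proof.
move=> H; have := sqr_ge0 b; have := sqr_ge0 c; have := sqr_ge0 d.
have := sqr_ge0 a; rewrite !expr2 => *; apply/eqP.
by rewrite -sqrf_eq0 expr2; apply/eqP; lia.
Qed.

Lemma max_dvd (m y : int) : 4 * (y * y) = m * m -> (m %| 2 * y)%Z.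
Proof.
move=> H; have : (2 * y - m) * (2 * y + m) == 0 by apply/eqP; lia.
rewrite mulf_eq0 => /orP[/eqP|/eqP] Hy; apply/dvdzP; first by exists 1; lia.
by exists (-1); lia.
Qed.

(** With y_i the least absolute residue of x_i modulo m, the sum of the y_i^2 is m r with r <= m.
    Euler's identity for the x_i and y_i, divided by m^2, represents r p. In the extreme cases all
    y_i vanish or all are +-m/2, and then m divides p. *)
Lemma sum4sq_descent (m p : int) : 1 < m -> sum4sq (m * p) ->
  (m %| p)%Z \/ exists2 r, 0 < r < m & sum4sq (r * p).
Proof.
move=> m1 [x1 [x2 [x3 [x4 E]]]]; have m0 : 0 < m by lia.
have [k1 [y1 [E1 b1]]] := round_div x1 m0.
have [k2 [y2 [E2 b2]]] := round_div x2 m0.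
have [k3 [y3 [E3 b3]]] := round_div x3 m0.
have [k4 [y4 [E4 b4]]] := round_div x4 m0.
pose r := p - 2 * (k1 * x1 + k2 * x2 + k3 * x3 + k4 * x4)
  + m * (k1 * k1 + k2 * k2 + k3 * k3 + k4 * k4).
have Er : m * r = y1 * y1 + y2 * y2 + y3 * y3 + y4 * y4.
  rewrite /r mulrDr mulrBr E.
  have -> : y1 = x1 - k1 * m by lia.
  have -> : y2 = x2 - k2 * m by lia.
  have -> : y3 = x3 - k3 * m by lia.
  have -> : y4 = x4 - k4 * m by lia.
  by ring.
have sq_le y : - m <= 2 * y <= m -> 4 * (y * y) <= m * m by move=> ?; nia.
have := (sq_le _ b1, sq_le _ b2, sq_le _ b3, sq_le _ b4).
move=> -[[[q1 q2] q3] q4].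
have r0 : 0 <= r by rewrite -(pmulr_rge0 _ m0) Er -!expr2 !addr_ge0 ?sqr_ge0.
have rm : r <= m.
  by rewrite -(ler_pM2l m0) Er; move: q1 q2 q3 q4; clear; lia.
have Ep : p = r
    + (k1 * (2 * y1) + k2 * (2 * y2) + k3 * (2 * y3) + k4 * (2 * y4))
    + (k1 * k1 + k2 * k2 + k3 * k3 + k4 * k4) * m.
  by rewrite /r E1 E2 E3 E4; ring.
have dvd_p : (m %| r)%Z -> (m %| 2 * y1)%Z -> (m %| 2 * y2)%Z ->
    (m %| 2 * y3)%Z -> (m %| 2 * y4)%Z -> (m %| p)%Z.
  move=> dr d1 d2 d3 d4; rewrite Ep; apply: rpredD; last exact/dvdz_mull/dvdzz.
  by apply: rpredD => //; do !apply: rpredD; apply: dvdz_mull.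
have [r_eq0|r_neq0] := eqVneq r 0; last have [r_eqm|r_neqm] := eqVneq r m.
- rewrite r_eq0 mulr0 in Er; left; apply: dvd_p.
  + by rewrite r_eq0 dvdz0.
  + by rewrite (sum4_eq0 Er) mulr0 dvdz0.
  + by rewrite (@sum4_eq0 y2 y1 y3 y4) ?mulr0 ?dvdz0 // Er; ring.
  + by rewrite (@sum4_eq0 y3 y1 y2 y4) ?mulr0 ?dvdz0 // Er; ring.
  by rewrite (@sum4_eq0 y4 y1 y2 y3) ?mulr0 ?dvdz0 // Er; ring.
- rewrite r_eqm in Er; left; apply: dvd_p; first by rewrite r_eqm dvdzz.
  + by apply: max_dvd; move: Er q1 q2 q3 q4; clear; lia.
  + by apply: max_dvd; move: Er q1 q2 q3 q4; clear; lia.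
  + by apply: max_dvd; move: Er q1 q2 q3 q4; clear; lia.
  by apply: max_dvd; move: Er q1 q2 q3 q4; clear; lia.
right; exists r; first by rewrite !lt_neqAle eq_sym r_neq0 r0 r_neqm.
(* Euler's four forms in the x_i and y_i, already divided by m thanks to y_i = x_i - k_i m. *)
pose w1 := p - (k1 * x1 + k2 * x2 + k3 * x3 + k4 * x4).
pose w2 := x1 * k2 - x2 * k1 + x3 * k4 - x4 * k3.
pose w3 := x1 * k3 - x3 * k1 + x4 * k2 - x2 * k4.
pose w4 := x1 * k4 - x4 * k1 + x2 * k3 - x3 * k2.
exists w1, w2, w3, w4; have mm : m * m != 0 by rewrite mulf_neq0 // gt_eqF.
apply: (mulfI mm).
have W1 : m * w1 = x1 * y1 + x2 * y2 + x3 * y3 + x4 * y4.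
  by rewrite /w1 mulrBr E E1 E2 E3 E4; ring.
have W2 : m * w2 = x2 * y1 - x1 * y2 + x4 * y3 - x3 * y4.
  by rewrite /w2 E1 E2 E3 E4; ring.
have W3 : m * w3 = x3 * y1 - x1 * y3 + x2 * y4 - x4 * y2.
  by rewrite /w3 E1 E2 E3 E4; ring.
have W4 : m * w4 = x4 * y1 - x1 * y4 + x3 * y2 - x2 * y3.
  by rewrite /w4 E1 E2 E3 E4; ring.
have -> : m * m * (r * p) = (m * r) * (m * p) by ring.
have -> : m * m * (w1 * w1 + w2 * w2 + w3 * w3 + w4 * w4) =
  (m * w1) * (m * w1) + (m * w2) * (m * w2) + (m * w3) * (m * w3)
  + (m * w4) * (m * w4) by ring.
by rewrite W1 W2 W3 W4 Er E; ring.
Qed.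

(** For 0 <= i, j <= (p - 1)/2 the values i^2 are distinct in F_p, and so are the -1 - j^2; these
    are p + 1 values in all, so some i^2 equals some -1 - j^2. *)
Lemma sqr_pigeonhole p : prime p -> odd p ->
  exists a b : nat,
    (p %| a * a + b * b + 1)%N /\ (2 * a < p)%N /\ (2 * b < p)%N.
Proof.
move=> pr_p odd_p; pose h := p./2.
have Ep : p = h.*2.+1 by rewrite -[LHS]odd_double_half odd_p.
pose f (i : 'I_h.+1) : 'F_p := i%:R ^+ 2.
pose g (i : 'I_h.+1) : 'F_p := - 1 - i%:R ^+ 2.
have sqr_inj (i j : 'I_h.+1) : f i = f j -> i = j.
  rewrite /f => /eqP; rewrite -subr_eq0 subr_sqr mulf_eq0.
  have pchF := pchar_Fp pr_p.
  wlog le_ji : i j / (j <= i)%N => [th|].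
    case: (leqP j i) => [le|/ltnW le]; first exact: th.
    move=> /orP[H|H]; apply/esym/th => //; apply/orP; [left|right].
      by rewrite subr_eq0 eq_sym -subr_eq0.
    by rewrite addrC.
  rewrite -natrB // -natrD -!(dvdn_pcharf pchF).
  have ltj := ltn_ord j; have lti := ltn_ord i.
  move=> /orP[] dv; apply/val_inj => /=.
    by case: (posnP (i - j)%N) => [|pos]; [|have := dvdn_leq pos dv]; lia.
  by case: (posnP (i + j)%N) => [|pos]; [|have := dvdn_leq pos dv]; lia.
have finj : injective f by move=> i j /sqr_inj.
have ginj : injective g by move=> i j /addrI/oppr_inj/sqr_inj.
have [disj|] := boolP [disjoint f @: setT & g @: setT].
  have := subset_leq_card (subsetT (f @: setT :|: g @: setT)).
  rewrite cardsU (disjoint_setI0 disj) cards0 subn0 !card_imset //.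
  by rewrite !cardsT card_Fp // !card_ord; lia.
rewrite -setI_eq0 => /set0Pn[x]; rewrite inE.
move=> /andP[/imsetP[i _ ->] /imsetP[j _ E]].
exists i, j; have lti := ltn_ord i; have ltj := ltn_ord j; split; last by lia.
rewrite (dvdn_pcharf (pchar_Fp pr_p)) !natrD !natrM -!expr2.
by move: E; rewrite /f /g => ->; apply/eqP; ring.
Qed.

Lemma sum4sq_prime p : prime p -> sum4sq p%:Z.
Proof.
move=> pr_p; case: (even_prime pr_p) => [->|odd_p]; first by exists 1, 1, 0, 0.
have [m [m0 ltm Hm]] : exists m : nat,
    [/\ (0 < m)%N, (m < p)%N & sum4sq (m%:Z * p%:Z)].
  have [a [b [/dvdnP[m Em] [lta ltb]]]] := sqr_pigeonhole pr_p odd_p.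
  exists m; split; last by exists a%:Z, b%:Z, 1, 0; lia.
    by case: m Em => //; rewrite mul0n addn1.
  rewrite -(ltn_pmul2r (prime_gt0 pr_p)) -Em.
  have := leq_mul (prime_gt1 pr_p) (prime_gt1 pr_p).
  by have := leq_mul lta lta; have := leq_mul ltb ltb; clear; lia.
elim/ltn_ind: m m0 ltm Hm => m IHm m0 ltm Hm.
have [m1|m_neq1] := eqVneq m 1%N; first by rewrite m1 mul1r in Hm.
have [|dv|[r /andP[r0 ltr] Hr]] := sum4sq_descent _ Hm; first by lia.
  have dvn : (m %| p)%N by rewrite dvdzE in dv.
  have [_ /(_ m dvn)/orP[/eqP m1|/eqP mp]] := primeP pr_p.
    by rewrite m1 in m_neq1.
  by rewrite mp ltnn in ltm.
have Er : r = `|r|%N by rewrite gez0_abs // ltW.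
rewrite Er in r0 ltr Hr; apply: (IHm `|r|%N) => //.
by apply: ltn_trans ltr ltm.
Qed.

Lemma four_squares n : sum4sq n%:Z.
Proof.
elim/ltn_ind: n => n IHn; case: (ltngtP n 1) => [n0|n1|->].
- by exists 0, 0, 0, 0; lia.
- have dv := pdiv_dvd n; rewrite -(divnK dv) PoszM.
  apply: sum4sqM; last exact/sum4sq_prime/pdiv_prime.
  by apply: IHn; rewrite ltn_Pdiv ?prime_gt1 ?pdiv_prime //; lia.
by exists 1, 0, 0, 0.
Qed.
End FourSquares.

(** * Exponents modulo (X - 1)^3 *)

Import Order.TTheory GRing.Theory Num.Theory.

Section LaurentFunctionals.
Local Open Scope ring_scope.

(** The additive extension of X^e |-> phi(e). For phi(e) = e and e^2 it amounts to the first two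
    derivatives at X = 1. *)
Definition list_functional (phi : int -> int) (s : seq (int * int)) : int :=
  \sum_(t <- s) t.1 * phi t.2.

(** Independence of the monomials: multiplication by a large X^N gives a genuine polynomial, whose
    coefficients all vanish. It makes [functional] independent of the chosen representation. *)
Lemma lpoly_sum_eq0 phi s : lpoly_sum s = 0 -> list_functional phi s = 0.
Proof.
move=> s0; pose N := (\sum_(t <- s) `|t.2|)%N.
have leN t : t \in s -> (`|t.2| <= N)%N.
  by move=> ts; rewrite /N (big_rem t ts) /= leq_addr.
pose P : {poly int} := \sum_(t <- s) 'X^`|t.2 + N%:Z| *~ t.1.
have P0 : P = 0.
  apply/eqP; rewrite -tofrac_eq0; apply/eqP.
  transitivity (tofrac 'X ^ N%:Z * lpoly_sum s); last by rewrite s0 mulr0.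
  rewrite /P raddf_sum mulr_sumr big_seq [RHS]big_seq; apply: eq_bigr => t ts.
  have := leN t ts => leNt.
  rewrite mulrzAr -expfzDr ?fracX_neq0 // raddfMz /= tofracXn exprnP.
  congr (_ ^ _ *~ _).
  by move: leNt; case: t {ts} => c e /=; lia.
pose B := N.*2.+1.
transitivity (\sum_(k < B) P`_k * phi (k%:Z - N%:Z)); last first.
  by rewrite P0 big1 // => k _; rewrite coef0 mul0r.
under eq_bigr => k _ do rewrite /P coef_sum mulr_suml.
rewrite exchange_big /= /list_functional big_seq [RHS]big_seq.
apply: eq_bigr => -[c e] ts; have /= leNt := leN _ ts.
have lt : (`|(e + N%:Z)%R| < B)%N by rewrite /B; lia.
rewrite (bigD1 (Ordinal lt)) //= coefMrz coefXn eqxx intz big1 ?addr0.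
  by congr (_ * phi _); lia.
move=> k; rewrite -val_eqE /= coefMrz coefXn => /negPf->.
by rewrite mul0rz mul0r.
Qed.

Lemma lpoly_surj (f : laurent) : exists s, f = lpoly s.
Proof. by have /is_laurentP[s Es] := valP f; exists s; apply: val_inj. Qed.

Definition functional (phi : int -> int) (f : laurent) : int :=
  list_functional phi (sval (cid (lpoly_surj f))).

Lemma lpolyD s t : lpoly s + lpoly t = lpoly (s ++ t).
Proof. by apply: val_inj; rewrite /= lpoly_sum_cat. Qed.

Lemma lpolyN s : - lpoly s = lpoly [seq (- t.1, t.2) | t <- s].
Proof.
apply: val_inj; rewrite /= /lpoly_sum big_map -sumrN.
by apply: eq_bigr => t _; rewrite mulrNz.
Qed.

Lemma lpoly_mulX s k : lpoly s * lX k = lpoly [seq (t.1, t.2 + k) | t <- s].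
Proof.
apply: val_inj; rewrite /= lpoly_sum1 mulr1z /lpoly_sum big_map mulr_suml.
by apply: eq_bigr => t _; rewrite expfzDr ?fracX_neq0 // mulrzAl.
Qed.

Lemma list_functional_cat phi s t :
  list_functional phi (s ++ t) = list_functional phi s + list_functional phi t.
Proof. exact: big_cat. Qed.

Lemma list_functionalN phi s :
  list_functional phi [seq (- t.1, t.2) | t <- s] = - list_functional phi s.
Proof.
rewrite /list_functional big_map -sumrN; apply: eq_bigr => t _.
by rewrite mulNr.
Qed.

Lemma functionalE phi s : functional phi (lpoly s) = list_functional phi s.
Proof.
rewrite /functional; case: cid => t /= Et; apply/eqP; rewrite -subr_eq0.
rewrite -list_functionalN -list_functional_cat; apply/eqP/lpoly_sum_eq0.
have : lpoly t - lpoly s = 0 by rewrite Et subrr.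
by rewrite lpolyN lpolyD => /(congr1 val).
Qed.

Lemma functionalD phi f g :
  functional phi (f + g) = functional phi f + functional phi g.
Proof.
have [[s ->] [t ->]] := (lpoly_surj f, lpoly_surj g).
by rewrite lpolyD !functionalE list_functional_cat.
Qed.

Lemma functionalN phi f : functional phi (- f) = - functional phi f.
Proof.
by have [s ->] := lpoly_surj f; rewrite lpolyN !functionalE list_functionalN.
Qed.

Lemma functionalX phi k : functional phi (lX k) = phi k.
Proof. by rewrite functionalE /list_functional big_seq1 mul1r. Qed.

Lemma functional_mulX phi f k :
  functional phi (f * lX k) = functional (fun e => phi (e + k)) f.
Proof.
have [s ->] := lpoly_surj f; rewrite lpoly_mulX !functionalE.
by rewrite /list_functional big_map.
Qed.

Definition cubeX1 : laurent := (lX 1 - 1) ^+ 3.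

(** Multiplication by (X - 1)^3 replaces phi by its third difference, so polynomials phi of degree
    at most 2 are well defined modulo the cube. *)
Lemma functional_cube phi f :
  (forall e, phi (e + 3) - 3 * phi (e + 2) + 3 * phi (e + 1) - phi e = 0) ->
  functional phi (f * cubeX1) = 0.
Proof.
move=> phi3.
have -> : f * cubeX1 = f * lX 3 - (f * lX 2 + f * lX 2 + f * lX 2)
    + (f * lX 1 + f * lX 1 + f * lX 1) - f.
  have -> : lX 3 = lX 1 * lX 1 * lX 1 by rewrite -!lXD.
  have -> : lX 2 = lX 1 * lX 1 by rewrite -!lXD.
  by rewrite /cubeX1; ring.
rewrite !(functionalD, functionalN) !functional_mulX.
have [s ->] := lpoly_surj f; rewrite !functionalE /list_functional.
rewrite -!big_split /= -!sumrN -!big_split /= big1 // => t _.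
have := congr1 ( *%R t.1) (phi3 t.2); rewrite mulr0 => <-.
by ring.
Qed.

Definition cubeX1_dvd (f : laurent) : Prop := exists q, f = q * cubeX1.

Lemma lX_taylor (z : int) : exists (t : int) (q : laurent),
  2 * t = z * (z - 1) /\
  lX z = 1 + z%:~R * (lX 1 - 1) + t%:~R * (lX 1 - 1) ^+ 2 + q * cubeX1.
Proof.
elim/int_ind: z => [|n [t [q [Et Eq]]]|n [t [q [Et Eq]]]].
- by exists 0, 0; split=> //; rewrite lX0; ring.
- exists (t + n%:Z), (t%:~R + q * lX 1); split; first by lia.
  by rewrite intS addrC lXD Eq /cubeX1; ring.
pose t' : int := t + n%:Z + 1.
(* Found by comparing the two expansions after multiplication by X = 1 + (X - 1). *)
exists t', (lX (-1) * (q - t'%:~R)); split; first by rewrite /t'; lia.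
have X1 : lX (-1) * lX 1 = 1 by rewrite -lXD lX0.
have X1K f : f = lX (-1) * (lX 1 * f) by rewrite mulrA X1 mul1r.
have -> : - n.+1%:Z = - n%:Z - 1 by rewrite intS; ring.
rewrite lXD mulrC Eq [X in _ = X + _]X1K /cubeX1.
rewrite -[X in _ = _ + X]mulrA -mulrDr.
by congr (_ * _); rewrite /t'; ring.
Qed.

Lemma lX_eq_mod (z n : int) : cubeX1_dvd (lX z - lX n) <-> z = n.
Proof.
split=> [[q Eq]|->]; last by exists 0; rewrite subrr mul0r.
have := functional_cube q (phi := id); rewrite -Eq.
rewrite functionalD functionalN !functionalX /= => H; apply/eqP.
by rewrite -subr_eq0 H // => e; ring.
Qed.

(* Modulo (X - 1)^3, the coefficient of X - 1 is x + y - s, and for s = x + y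
   that of (X - 1)^2 is binom x 2 + binom y 2 - binom s 2 + w = w - x y. *)
Definition gadget (x y s w : int) : laurent :=
  lX x + lX y - lX s + (lX 1 - 1) * lX w - lX 1.

(** The functional for e yields x + y - s = 0, and the one for e^2 yields x^2 + y^2 - s^2 + 2 w = 0.
    The converse follows from the Taylor expansions. *)
Lemma gadgetP x y s w : cubeX1_dvd (gadget x y s w) <-> s = x + y /\ w = x * y.
Proof.
split=> [[q Eq]|[-> ->]].
  have gE phi : functional phi (gadget x y s w) =
      phi x + phi y - phi s + phi (1 + w) - phi w - phi 1.
    rewrite /gadget mulrBl mul1r -lXD !(functionalD, functionalN) !functionalX.
    by ring.
  have := functional_cube q (phi := id); rewrite -Eq gE => /= H1.
  have {}H1 := H1 (fun e => ltac:(ring)).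
  have Es : s = x + y by move: H1; clear; lia.
  split=> //; have := functional_cube q (phi := fun e => e * e).
  rewrite -Eq gE => /= H2; have {}H2 := H2 (fun e => ltac:(ring)).
  by move: H2; rewrite Es; clear; lia.
have [tx [qx [Etx Ex]]] := lX_taylor x; have [ty [qy [Ety Ey]]] := lX_taylor y.
have [ts [qs [Ets Es]]] := lX_taylor (x + y).
have [tw [qw [Etw Ew]]] := lX_taylor (x * y).
exists (qx + qy - qs + (lX 1 - 1) * qw + tw%:~R); rewrite /gadget Ex Ey Es Ew.
have -> : ts = tx + ty + x * y by lia.
by rewrite /cubeX1; ring.
Qed.
End LaurentFunctionals.

(** * The groups (Z[X, 1/X]/(X - 1)^3)^D x| Z *)

Section SemidirectConjugates.
Local Open Scope ring_scope.
Variable A : lmodType laurent.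
Implicit Types (a b : A) (g : sdprodZ A).

Lemma sd_mulE g h : (g * h)%g =
  SdprodZ (sd_vec g + lX (sd_exp g) *: sd_vec h) (sd_exp g + sd_exp h).
Proof. by []. Qed.

Lemma sd_mul0 a b : (SdprodZ a 0 * SdprodZ b 0)%g = SdprodZ (a + b) 0.
Proof. by rewrite sd_mulE /= lX0 scale1r addr0. Qed.

Lemma sd_conj g b : (g * SdprodZ b 0 * g^-1)%g = SdprodZ (lX (sd_exp g) *: b) 0.
Proof.
rewrite !sd_mulE /= addr0 subrr scalerN scalerA -lXD subrr lX0 scale1r.
by congr SdprodZ; rewrite addrAC subrr add0r.
Qed.

Lemma sd_prod0 (I : Type) (r : seq I) (F : I -> A) :
  (\prod_(i <- r) SdprodZ (F i) 0)%g = SdprodZ (\sum_(i <- r) F i) 0.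
Proof.
elim: r => [|i r IHr]; first by rewrite !big_nil.
by rewrite !big_cons IHr sd_mul0.
Qed.

Lemma sd_abelian_by_cyclic : abelian_by_cyclic (sdprodZ A).
Proof.
exists (fun g => sd_exp g = 0); split.
- by split=> // x y x0 y0; rewrite sd_mulE /= x0 y0 subrr.
- move=> [a x] [b y] /= -> ->; rewrite !sd_mul0; congr SdprodZ; exact: addrC.
- by move=> x g x0; rewrite !sd_mulE /= x0 addr0 subrr.
exists (@sd_exp A); split=> // [z|x y]; first by exists (SdprodZ 0 z).
rewrite sd_mulE /=; split=> [->|]; first by rewrite addNr.
by move=> /eqP; rewrite addrC subr_eq0 => /eqP.
Qed.
End SemidirectConjugates.

Section CubeModule.
Local Open Scope ring_scope.
Variable D : nat.

Lemma submod1 (v : 'rV[laurent]_D) : submod 1%:M v.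
Proof. by apply/submodP; exists v; rewrite mulmx1. Qed.

Definition cube_module : fp_module :=
  @FpModule D D D 1%:M cubeX1%:M (fun v _ => submod1 v).

Local Notation A := (fp_quot cube_module).

Lemma submod_cubeP (v : 'rV[laurent]_D) :
  submod (cubeX1%:M : 'M_D) v <-> forall j, cubeX1_dvd (v 0 j).
Proof.
split=> [/submodP[c ->] j|/choice[q Eq]].
  by exists (c 0 j); rewrite mul_mx_scalar mxE mulrC.
apply/submodP; exists (\row_j q j); apply/rowP => j.
by rewrite mul_mx_scalar !mxE Eq mulrC.
Qed.

Definition cls (v : 'rV[laurent]_D) : A :=
  @fp_pi cube_module (Submod (submod1 v)).

Lemma clsP u v : cls u = cls v <-> forall j, cubeX1_dvd (u 0 j - v 0 j).
Proof.
rewrite /cls fp_piP /= submod_cubeP.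
by split=> H j; have := H j; rewrite !mxE.
Qed.

Lemma clsD u v : cls (u + v) = cls u + cls v.
Proof. by rewrite /cls -fp_piD; congr fp_pi; apply: val_inj. Qed.

Lemma clsZ a v : cls (a *: v) = a *: cls v.
Proof.
rewrite /cls -[RHS]/(fp_scale _ _) -fp_piZ; congr fp_pi; exact: val_inj.
Qed.

Lemma cls0 : cls 0 = 0.
Proof. by apply/(addrI (cls 0)); rewrite -clsD !addr0. Qed.

Lemma cls_sum (I : Type) (r : seq I) (F : I -> 'rV[laurent]_D) :
  cls (\sum_(i <- r) F i) = \sum_(i <- r) cls (F i).
Proof.
by elim: r => [|i r IHr]; rewrite ?big_nil ?cls0 // !big_cons clsD IHr.
Qed.

Lemma cls_eq0 v : cls v = 0 <-> forall j, cubeX1_dvd (v 0 j).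
Proof.
rewrite -cls0 clsP; split=> H j; have := H j; by rewrite !mxE subr0.
Qed.

Lemma cls_surj x : exists v, x = cls v.
Proof.
have [[v vM] ->] := fp_pi_surj x; exists v.
by rewrite /cls; congr fp_pi; apply: val_inj.
Qed.

Definition elt v : sdprodZ A := SdprodZ (cls v) 0.

Lemma input_rowP (v : 'rV[laurent]_D) :
  exists c : D.-tuple (seq (int * int)), @input_row cube_module c = v.
Proof.
exists [tuple sval (cid (lpoly_surj (v 0 j))) | j < D].
apply/rowP => j; rewrite mxE tnth_mktuple.
by case: cid.
Qed.

Definition row_input (c : D.-tuple (seq (int * int))) : elt_input cube_module :=
  @EltInput cube_module c 0 (submod1 _).

Lemma elt_of_row_input c :
  elt_of_input (row_input c) = elt (@input_row cube_module c).
Proof.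
by rewrite /elt_of_input /elt /cls; congr (SdprodZ (fp_pi _) _); apply: val_inj.
Qed.

(** Dividing by the power of X that comes from g0 leaves only the differences of exponents, so g0
    may be taken trivial. *)
Lemma conj_equationP (m : nat) (h0 : 'rV[laurent]_D)
    (h : 'I_m -> 'rV[laurent]_D) :
  (exists g0 (g : 'I_m -> sdprodZ A),
    (g0 * elt h0 * g0^-1 * \prod_(i < m) (g i * elt (h i) * (g i)^-1) = 1)%g) <->
  exists z : 'I_m -> int, forall j,
    cubeX1_dvd (h0 0 j + \sum_(i < m) lX (z i) * h i 0 j).
Proof.
have prodE g0 (g : 'I_m -> sdprodZ A) :
    (g0 * elt h0 * g0^-1 * \prod_(i < m) (g i * elt (h i) * (g i)^-1) =
     elt (lX (sd_exp g0) *: h0 + \sum_(i < m) lX (sd_exp (g i)) *: h i))%g.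
  rewrite /elt sd_conj; under eq_bigr => i _ do rewrite sd_conj.
  rewrite sd_prod0 sd_mul0 clsD clsZ cls_sum; congr (SdprodZ (_ + _) _).
  by apply: eq_bigr => i _; rewrite clsZ.
have eltE v : elt v = 1%g <-> cls v = 0.
  by split=> [/(congr1 (@sd_vec _))|E] //; rewrite /elt E.
split=> [[g0 [g]]|[z Hz]].
  rewrite prodE eltE cls_eq0 => Hg.
  exists (fun i => sd_exp (g i) - sd_exp g0) => j.
  have [q Eq] := Hg j; exists (lX (- sd_exp g0) * q).
  rewrite -mulrA -Eq !mxE mulrDr summxE mulrA -lXD addNr lX0 mul1r.
  congr (_ + _); rewrite mulr_sumr; apply: eq_bigr => i _.
  by rewrite !mxE mulrA -lXD [- _ + _]addrC.
exists 1%g, (fun i => SdprodZ 0 (z i)); rewrite prodE eltE cls_eq0 => j.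
have := Hz j; rewrite /= !mxE lX0 mul1r summxE.
by under [X in _ -> cubeX1_dvd (_ + X)]eq_bigr => i _ do rewrite mxE.
Qed.

Definition generated (G : groupType) (s : seq G) (x : G) : Prop :=
  exists w : seq G, all (fun y => (y \in s) || ((y^-1)%g \in s)) w /\
    x = (\prod_(y <- w) y)%g.

Lemma generatedM (G : groupType) (s : seq G) x y :
  generated s x -> generated s y -> generated s (x * y)%g.
Proof.
move=> [w [aw ->]] [w' [aw' ->]]; exists (w ++ w').
by rewrite all_cat aw aw' big_cat.
Qed.

Lemma generated_gen (G : groupType) (s : seq G) x : x \in s -> generated s x.
Proof. by move=> xs; exists [:: x]; rewrite /= xs big_seq1. Qed.

Lemma generated1 (G : groupType) (s : seq G) : generated s 1%g.
Proof. by exists [::]; rewrite big_nil. Qed.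

Lemma generatedV (G : groupType) (s : seq G) x :
  generated s x -> generated s (x^-1)%g.
Proof.
move=> [w [aw ->]]; elim: w aw => [_|y w IHw /= /andP[ys /IHw gw]].
  by rewrite big_nil invg1; exact: generated1.
rewrite big_cons invgM; apply: generatedM gw _.
by exists [:: (y^-1)%g]; rewrite /= invgK orbC ys big_seq1.
Qed.

(** Conjugation by t = (0, 1) multiplies by X, so t and the basis vectors generate all Laurent
    multiples of the latter. *)
Lemma cube_finitely_generated : finitely_generated (sdprodZ A).
Proof.
pose t : sdprodZ A := SdprodZ 0 1.
pose s := t :: [seq elt (delta_mx 0 j) | j <- enum 'I_D].
exists s => x; rewrite -/(generated s x).
have gT (z : int) : generated s (SdprodZ 0 z : sdprodZ A).
  have gt : generated s t by apply: generated_gen; rewrite mem_head.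
  elim/int_ind: z => [|n IHn|n IHn]; first exact: generated1.
    have := generatedM IHn gt; rewrite sd_mulE /= scaler0 addr0.
    by rewrite intS addrC.
  have := generatedM IHn (generatedV gt); rewrite sd_mulE /=.
  by rewrite !scaler0 oppr0 scaler0 addr0 intS opprD addrC.
pose V a := generated s (SdprodZ a 0 : sdprodZ A).
have VD a b : V a -> V b -> V (a + b).
  by move=> Va Vb; rewrite /V -sd_mul0; apply: generatedM.
have VN a : V a -> V (- a).
  move=> /generatedV; rewrite /V; congr generated.
  by congr SdprodZ; rewrite /= oppr0 lX0 scale1r.
have VX k a : V a -> V (lX k *: a).
  move=> Va; have := generatedM (generatedM (gT k) Va) (generatedV (gT k)).
  by rewrite sd_conj.
have V0 : V 0 by exact: generated1.
have VZ f a : V a -> V (f *: a).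
  move=> Va; have [l ->] := lpoly_surj f; elim: l => [|[c e] l IHl].
    have -> : lpoly [::] = 0 by apply: val_inj; rewrite /= /lpoly_sum big_nil.
    by rewrite scale0r.
  rewrite -cat1s -lpolyD scalerDl; apply: (VD _ _ _ IHl).
  have VXe := VX e a Va.
  have addc (c1 c2 : int) :
      lpoly [:: (c1 + c2, e)] = lpoly [:: (c1, e)] + lpoly [:: (c2, e)].
    by apply: val_inj; rewrite /= !lpoly_sum1 mulrzDr.
  have lpoly0 : lpoly [:: (0, e)] = 0.
    by apply: val_inj; rewrite /= lpoly_sum1 mulr0z.
  have lpolyN1 : lpoly [:: (-1, e)] = - lX e by rewrite lpolyN.
  elim/int_ind: c => [|n IHn|n IHn]; first by rewrite lpoly0 scale0r.
    by rewrite intS addc scalerDl; apply: VD.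
  rewrite intS opprD addc lpolyN1 scalerDl scaleNr; apply: (VD _ _ _ IHn).
  exact: VN.
case: x => a z.
have -> : SdprodZ a z = (SdprodZ a 0 * SdprodZ 0 z)%g.
  by rewrite sd_mulE /= scaler0 addr0 add0r.
apply: generatedM (gT z); rewrite -/(V a).
have [v ->] := cls_surj a; rewrite (row_sum_delta v) cls_sum.
elim/big_ind: _ => // j _; rewrite clsZ; apply: VZ.
by apply: generated_gen; rewrite inE map_f ?orbT ?mem_enum.
Qed.
End CubeModule.

(** * Equations as exponent systems *)

Section IntegerEquation.
Local Open Scope ring_scope.

(** All parameters are read as n, since a set of naturals needs only one. *)
Fixpoint zeval (n : int) (w : nat -> int) (e : pexp) : int :=
  match e with
  | Cst c => c%:Z
  | Par _ => n
  | Ex i => w i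
  | Add a b => zeval n w a + zeval n w b
  | Mul a b => zeval n w a * zeval n w b
  end.

Definition ex4sq i : pexp :=
  let sq k := Mul (Ex (4 * i + k)) (Ex (4 * i + k)) in
  Add (Add (Add (sq 0%N) (sq 1%N)) (sq 2)) (sq 3).

Lemma zeval_ex4sq (n : nat) w (u : nat -> nat) e :
  (forall i, zeval n w (ex4sq i) = u i) ->
  zeval n w (psubst Par ex4sq e) = (peval (fun=> n) u e)%:Z.
Proof.
move=> Eu; elim: e => [//|//|i|a IHa b IHb|a IHa b IHb] /=; first exact: Eu.
  by rewrite IHa IHb PoszD.
by rewrite IHa IHb PoszM.
Qed.

Lemma dioph_int (K : nat -> Prop) : dioph (fun v => K (v 0%N)) ->
  exists e1 e2, forall n : nat,
    K n <-> exists w : nat -> int, zeval n w e1 = zeval n w e2.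
Proof.
move=> [e1 [e2 He]]; exists (psubst Par ex4sq e1), (psubst Par ex4sq e2) => n.
rewrite (He (fun=> n)); split=> [[u Eu]|[w Ew]].
  have /choice[s Es] : forall i, exists s : nat -> int,
      s 0%N * s 0%N + s 1%N * s 1%N + s 2 * s 2 + s 3 * s 3 = u i.
    move=> i; have [a [b [c [d Ei]]]] := four_squares (u i).
    by exists (nth 0 [:: a; b; c; d]).
  pose w j := s (j %/ 4)%N (j %% 4)%N; exists w.
  have wE i : zeval n w (ex4sq i) = u i.
    by rewrite -Es /= /w mulnC !divnMDl // !modnMDl /= !addn0.
  by rewrite !(zeval_ex4sq _ wE) Eu.
pose u i := `|zeval n w (ex4sq i)|%N; exists u.
have uE i : zeval n w (ex4sq i) = u i.
  by rewrite /u gez0_abs //= !addr_ge0 // -expr2 sqr_ge0.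
by move: Ew; rewrite !(zeval_ex4sq _ uE) => -[].
Qed.
End IntegerEquation.

HB.instance Definition _ := gen_eqMixin pexp.

(* One exponent per expression; the sum and the product of two expressions are
   produced together by [gadget], so both are listed. *)
Fixpoint subs (e : pexp) : seq pexp :=
  match e with
  | Add a b | Mul a b => Add a b :: Mul a b :: subs a ++ subs b
  | _ => [:: e]
  end.

Lemma mem_subs e : e \in subs e.
Proof. by case: e => *; rewrite !inE eqxx ?orbT. Qed.

Lemma subs_args e a b : (Add a b \in subs e) || (Mul a b \in subs e) ->
  [/\ a \in subs e, b \in subs e, Add a b \in subs e & Mul a b \in subs e].
Proof.
pose closed z := (Add a b \in subs z) || (Mul a b \in subs z) ->
  [/\ a \in subs z, b \in subs z, Add a b \in subs z & Mul a b \in subs z].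
have node x y : closed x -> closed y -> closed (Add x y).
  move=> IHx IHy; rewrite /closed /= !inE !mem_cat => H.
  have [|Hx] := boolP ((Add a b \in subs x) || (Mul a b \in subs x)).
    by move=> /IHx[-> -> -> ->]; rewrite !orbT.
  have [|Hy] := boolP ((Add a b \in subs y) || (Mul a b \in subs y)).
    by move=> /IHy[-> -> -> ->]; rewrite !orbT.
  have [-> ->] : a = x /\ b = y; last by rewrite !eqxx !mem_subs !orbT.
  move: Hx Hy H; rewrite !negb_or => /andP[/negPf-> /negPf->].
  move=> /andP[/negPf-> /negPf->]; rewrite !orbF.
  by case/orP => /orP[/eqP|/eqP] // [].
rewrite -/(closed e).
elim: e => [c|i|i|x IHx y IHy|x IHx y IHy]; try exact: node.
- by rewrite /closed !inE => /orP[] /eqP.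
- by rewrite /closed !inE => /orP[] /eqP.
by rewrite /closed !inE => /orP[] /eqP.
Qed.

Section ExponentSystem.
Local Open Scope ring_scope.
Variables e1 e2 : pexp.

Definition unknowns : seq pexp := undup (subs e1 ++ subs e2).

Lemma unknowns_args a b : (Add a b \in unknowns) || (Mul a b \in unknowns) ->
  [/\ a \in unknowns, b \in unknowns, Add a b \in unknowns
    & Mul a b \in unknowns].
Proof.
rewrite !mem_undup !mem_cat => H.
have /orP[/subs_args|/subs_args] :
  ((Add a b \in subs e1) || (Mul a b \in subs e1)) ||
  ((Add a b \in subs e2) || (Mul a b \in subs e2)) by rewrite orbACA.
  by move=> [-> -> -> ->].
by move=> [-> -> -> ->]; rewrite !orbT.
Qed.

Definition one_hot (x a : pexp) : laurent := (x == a)%:R.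

(* The coordinate attached to e as a linear form in the monomials X^(zeta x),
   without its constant term. *)
Definition coef (e x : pexp) : laurent :=
  match e with
  | Cst _ | Par _ => one_hot x e
  | Ex _ => 0
  | Add a b | Mul a b => one_hot x a + one_hot x b - one_hot x (Add a b)
      + (lX 1 - 1) * one_hot x (Mul a b)
  end.

(** The terms -X^c and -X^n fix the exponent of a leaf; (-1, 1) is the final term -X of [gadget]. *)
Definition const_list (n : nat) (e : pexp) : seq (int * int) :=
  match e with
  | Cst c => [:: (-1, c%:Z)]
  | Par _ => [:: (-1, n%:Z)]
  | Ex _ => [::]
  | Add _ _ | Mul _ _ => [:: (-1, 1)]
  end.

Lemma sum_one_hot (zeta : pexp -> int) a : a \in unknowns ->
  \sum_(x <- unknowns) lX (zeta x) * one_hot x a = lX (zeta a).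
Proof.
move=> aU; rewrite (bigD1_seq a) ?undup_uniq //= /one_hot eqxx mulr1.
by rewrite big1 ?addr0 // => x /negPf->; rewrite mulr0.
Qed.

Definition local_constraint (n : nat) (zeta : pexp -> int) (e : pexp) : Prop :=
  match e with
  | Cst c => zeta e = c%:Z
  | Par _ => zeta e = n%:Z
  | Ex _ => True
  | Add a b | Mul a b => zeta (Add a b) = zeta a + zeta b /\
                         zeta (Mul a b) = zeta a * zeta b
  end.

Lemma lpolyN1 (k : int) : lpoly [:: (-1, k)] = - lX k.
Proof. by rewrite lpolyN. Qed.

Lemma lpoly0 : lpoly [::] = 0.
Proof. by apply: val_inj; rewrite /= /lpoly_sum big_nil. Qed.

Lemma coordinateP n zeta e : e \in unknowns ->
  cubeX1_dvd (lpoly (const_list n e) +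
    \sum_(x <- unknowns) lX (zeta x) * coef e x) <-> local_constraint n zeta e.
Proof.
have node a b : a \in unknowns -> b \in unknowns -> Add a b \in unknowns ->
    Mul a b \in unknowns ->
  lpoly [:: (-1, 1)] + \sum_(x <- unknowns) lX (zeta x) * coef (Add a b) x =
  gadget (zeta a) (zeta b) (zeta (Add a b)) (zeta (Mul a b)).
  move=> aU bU sU pU; rewrite lpolyN1 /gadget /=.
  under eq_bigr => x _ do rewrite mulrDr mulrBr mulrDr mulrCA.
  rewrite !(big_split, sumrB) /= !sumrN -mulr_sumr !sum_one_hot //.
  by ring.
case: e => [c|i|i|a b|a b] eU /=.
- by rewrite sum_one_hot // lpolyN1 addrC lX_eq_mod.
- by rewrite sum_one_hot // lpolyN1 addrC lX_eq_mod.
- rewrite lpoly0 add0r big1 ?mulr0 // => [|x _]; last by rewrite mulr0.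
  by split=> // _; exists 0; rewrite mul0r.
- have [|aU bU sU pU] := @unknowns_args a b; first by rewrite eU.
  by rewrite -gadgetP -node.
have [|aU bU sU pU] := @unknowns_args a b; first by rewrite eU orbT.
by rewrite -gadgetP -node.
Qed.

Lemma systemP (n : nat) :
  (exists w, zeval n w e1 = zeval n w e2) <->
  (exists zeta : pexp -> int,
     (forall e, e \in unknowns -> local_constraint n zeta e) /\
     zeta e1 = zeta e2).
Proof.
split=> [[w Ew]|[zeta [Hz E12]]].
  by exists (zeval n w); split=> // -[].
exists (fun i => zeta (Ex i)).
have zE e : e \in unknowns -> zeta e = zeval n (fun i => zeta (Ex i)) e.
  elim: e => [c|i|i|a IHa b IHb|a IHa b IHb] eU; have /= := Hz _ eU; try by [].
    have [|aU bU _ _] := @unknowns_args a b; first by rewrite eU.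
    by move=> [-> _]; rewrite IHa // IHb.
  have [|aU bU _ _] := @unknowns_args a b; first by rewrite eU orbT.
  by move=> [_ ->]; rewrite IHa // IHb.
have [e1U e2U] : e1 \in unknowns /\ e2 \in unknowns.
  by rewrite !mem_undup !mem_cat !mem_subs !orbT.
by rewrite -!zE.
Qed.

Local Notation m := (size unknowns).
Local Notation D := m.+1.

(** Beyond one coordinate per unknown, the last coordinate imposes equal exponents for [e1] and
    [e2]. *)
Definition system_row (x : pexp) : 'rV[laurent]_D :=
  \row_(j < D) if (j < m)%N then coef (nth e1 unknowns j) x
               else one_hot x e1 - one_hot x e2.

Definition system_coef (i : 'I_m) : 'rV[laurent]_D :=
  system_row (nth e1 unknowns i).

Definition system_list (n : nat) (j : 'I_D) : seq (int * int) :=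
  if (j < m)%N then const_list n (nth e1 unknowns j) else [::].

Definition system_const (n : nat) : 'rV[laurent]_D :=
  \row_j lpoly (system_list n j).

Lemma system_solvable (n : nat) :
  (exists z : 'I_m -> int, forall j, cubeX1_dvd
     (system_const n 0 j + \sum_(i < m) lX (z i) * system_coef i 0 j)) <->
  exists w, zeval n w e1 = zeval n w e2.
Proof.
have [e1U e2U] : e1 \in unknowns /\ e2 \in unknowns.
  by rewrite !mem_undup !mem_cat !mem_subs !orbT.
have reindex (zeta : pexp -> int) j :
    \sum_(i < m) lX (zeta (nth e1 unknowns i)) * system_coef i 0 j =
    \sum_(x <- unknowns) lX (zeta x) * system_row x 0 j.
  by rewrite (big_nth e1) big_mkord.
have colP (zeta : pexp -> int) : (forall j, cubeX1_dvd (system_const n 0 j +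
      \sum_(x <- unknowns) lX (zeta x) * system_row x 0 j)) <->
    (forall e, e \in unknowns -> local_constraint n zeta e) /\
    zeta e1 = zeta e2.
  have lastE (j : 'I_D) : (j < m)%N = false -> system_const n 0 j +
      \sum_(x <- unknowns) lX (zeta x) * system_row x 0 j =
      lX (zeta e1) - lX (zeta e2).
    move=> Ej; under eq_bigr => x _ do rewrite mxE Ej mulrBr.
    by rewrite mxE /system_list Ej lpoly0 add0r sumrB !sum_one_hot.
  have nthE (j : 'I_D) : (j < m)%N -> cubeX1_dvd (system_const n 0 j +
      \sum_(x <- unknowns) lX (zeta x) * system_row x 0 j) <->
      local_constraint n zeta (nth e1 unknowns j).
    move=> ltj; under eq_bigr => x _ do rewrite mxE ltj.
    by rewrite mxE /system_list ltj coordinateP // mem_nth.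
  split=> [H|[H E] j].
    split=> [e /(nthP e1)[j ltj <-]|].
      exact: (proj1 (nthE (Ordinal (ltnW ltj : (j < D)%N)) ltj)).
    by apply/lX_eq_mod; rewrite -(lastE ord_max) //= ltnn.
  case: (ltnP j m) => [ltj|]; first by apply/nthE => //; apply/H/mem_nth.
  by rewrite leqNgt => /negbTE/lastE->; apply/lX_eq_mod.
rewrite systemP; split=> [[z Hz]|[zeta /colP Hzeta]].
  pose zeta x := if insub (index x unknowns) is Some i then z i else 0.
  exists zeta; apply/colP => j; rewrite -reindex; have := Hz j.
  congr (cubeX1_dvd (_ + _)); apply: eq_bigr => i _; congr (lX _ * _).
  by rewrite /zeta index_uniq ?undup_uniq // valK.
exists (fun i => zeta (nth e1 unknowns i)) => j; rewrite reindex.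
exact: Hzeta.
Qed.
End ExponentSystem.

(** * Computability of the instances *)

Lemma computable_id : computable id.
Proof.
exists (PR_pair PR_fst PR_snd) => n; have [a [b ->]] := cpair_surj n.
by constructor; constructor.
Qed.

Lemma computable_succ F : computable F -> computable (fun n => (F n).+1).
Proof.
move=> [f Hf]; exists (PR_comp PR_succ f) => n.
by apply: C_comp (Hf n) _; constructor.
Qed.

Lemma computable_cst c : computable (fun=> c).
Proof.
by elim: c => [|c]; [exists PR_zero; constructor | exact: computable_succ].
Qed.

Lemma computable_cpair F G : computable F -> computable G ->
  computable (fun n => cpair (F n) (G n)).
Proof.
by move=> [f Hf] [g Hg]; exists (PR_pair f g) => n; constructor.
Qed.

Lemma computable_double F : computable F -> computable (fun n => (F n).*2).
Proof.
move=> [f Hf].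
pose step := PR_comp PR_succ (PR_comp PR_succ (PR_comp PR_snd PR_snd)).
have stepE a n r : computes step (cpair a (cpair n r)) r.+2.
  by do ?[apply: C_comp]; constructor.
have doubleE n : computes (PR_rec PR_zero step) (cpair 0 n) n.*2.
  elim: n => [|n IHn]; first by do 2 constructor.
  by rewrite doubleS; apply: C_recS IHn _.
exists (PR_comp (PR_rec PR_zero step) (PR_pair PR_zero f)) => n.
by apply: C_comp (doubleE _); do ?constructor.
Qed.

Lemma computable_ext F G : F =1 G -> computable F -> computable G.
Proof. by move=> E [f Hf]; exists f => n; rewrite -E. Qed.

Lemma computable_enc_seq (A I : Type) (ea : A -> nat) (r : seq I)
    (F : I -> nat -> A) :
  (forall i, computable (fun n => ea (F i n))) ->
  computable (fun n => enc_seq ea [seq F i n | i <- r]).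
Proof.
move=> cF; elim: r => [|i r IHr]; first exact: computable_cst.
exact/computable_succ/computable_cpair.
Qed.

Lemma computable_const_list e :
  computable (fun n => enc_seq (enc_pair enc_int enc_int) (const_list n e)).
Proof.
case: e => *; try exact: computable_cst.
apply/computable_succ/computable_cpair; last exact: computable_cst.
apply/computable_cpair; first exact: computable_cst.
exact/computable_double/computable_id.
Qed.

Section Reductions.
Variables e1 e2 : pexp.
Local Notation m := (size (unknowns e1 e2)).
Local Notation P := (cube_module m.+1).

Definition const_tuple n : m.+1.-tuple (seq (int * int)) :=
  [tuple system_list n j | j < m.+1].

Definition conj_input n : elt_input P := row_input (const_tuple n).

Lemma elt_of_conj_input n :
  elt_of_input (conj_input n) = elt (system_const e1 e2 n).
Proof.
rewrite elt_of_row_input; congr elt; apply/rowP => j.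
by rewrite !mxE tnth_mktuple.
Qed.

Lemma computable_conj_input :
  computable (@enc_elt_input P \o conj_input).
Proof.
apply: computable_cpair; last exact: computable_cst.
apply: (computable_ext (F := fun n => enc_seq
    (enc_seq (enc_pair enc_int enc_int))
    [seq system_list n j | j <- enum 'I_m.+1])).
  by move=> n; congr enc_seq.
apply: computable_enc_seq => j; rewrite /system_list.
by case: (j < _)%N; [exact: computable_const_list | exact: computable_cst].
Qed.

(** In the quadratic problem the fixed elements are part of the input too. Any representatives do:
    being independent of n, they enter the instance map as constants. *)
Lemma coef_inputP : exists x : 'I_m -> elt_input P,
  forall i, elt_of_input (x i) = elt (system_coef i).
Proof.
have /choice[c Hc] := fun i : 'I_m => input_rowP (system_coef i).
by exists (fun i => row_input (c i)) => i; rewrite elt_of_row_input Hc.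
Qed.

(** The places 0, 1, 2 of a conjugate hold the variable, the constant and the inverse. Listing the
    letters by fixed positions suits [computable_enc_seq]. *)
Definition conj_letter (x : 'I_m.+1 -> elt_input P) (p : 'I_m.+1 * nat) :
    ('I_m.+1 * bool) + elt_input P :=
  if p.2 == 1%N then inr (x p.1) else inl (p.1, p.2 == 2).

Definition conj_positions : seq ('I_m.+1 * nat) :=
  [seq (i, k) | i <- enum 'I_m.+1, k <- [:: 0%N; 1%N; 2]].

Definition conj_word x : word (elt_input P) m.+1 :=
  [seq conj_letter x p | p <- conj_positions].

Lemma conj_wordE x : conj_word x =
  flatten [seq [:: inl (i, false); inr (x i); inl (i, true)]
             | i <- enum 'I_m.+1].
Proof. by rewrite /conj_word /conj_positions map_flatten -map_comp. Qed.

Lemma conj_word_quadratic x : quadratic (conj_word x).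
Proof.
move=> i; rewrite conj_wordE count_flatten -map_comp sumnE big_map big_enum /=.
rewrite (bigD1 i) //= eqxx big1 // => j; by rewrite eq_sym => /negPf->.
Qed.

Definition conj_quadratic x : quadratic_input P :=
  QuadraticInput (conj_word_quadratic x).

Lemma conj_quadratic_solvable x : equation_solvable (conj_quadratic x) <->
  exists g : 'I_m.+1 -> sdprodZ (fp_quot P),
    (\prod_(i < m.+1) (g i * elt_of_input (x i) * (g i)^-1) = 1)%g.
Proof.
have prodE (g : 'I_m.+1 -> sdprodZ (fp_quot P)) :
    word_eval (@elt_of_input P) g (conj_word x) =
    (\prod_(i < m.+1) (g i * elt_of_input (x i) * (g i)^-1))%g.
  rewrite /word_eval conj_wordE big_flatten big_map enumT.
  rewrite [index_enum _]unlock /=.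
  by apply: eq_bigr => i _; rewrite !big_cons big_nil /= mulg1 mulgA.
by split=> -[g Eg]; exists g; [rewrite -prodE | rewrite /= prodE].
Qed.

Definition with_head (x : 'I_m -> elt_input P) (n : nat) (i : 'I_m.+1) :=
  oapp x (conj_input n) (unlift ord0 i).

Lemma computable_conj_quadratic x :
  computable
    (@enc_quadratic_input P \o (fun n => conj_quadratic (with_head x n))).
Proof.
apply: computable_cpair; first exact: computable_cst.
apply: (computable_ext (F := fun n => enc_seq
    (enc_sum (enc_pair (@nat_of_ord m.+1) nat_of_bool) (@enc_elt_input P))
    [seq conj_letter (with_head x n) p | p <- conj_positions])) => //.
apply: (@computable_enc_seq _ _ _ _ (fun p n => conj_letter (with_head x n) p)).
move=> [i k]; rewrite /conj_letter /=.
case: (k == 1%N) => /=; last exact: computable_cst.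
apply/computable_succ/computable_double; rewrite /with_head.
case: unlift => [j|] /=; first exact: computable_cst.
exact: computable_conj_input.
Qed.

Lemma with_head_solvable x n :
  equation_solvable (conj_quadratic (with_head x n)) <->
  exists g0 (g : 'I_m -> sdprodZ (fp_quot P)),
    (g0 * elt_of_input (conj_input n) * g0^-1 *
       \prod_(i < m) (g i * elt_of_input (x i) * (g i)^-1) = 1)%g.
Proof.
rewrite conj_quadratic_solvable; split=> [[g]|[g0 [g Eg]]].
  rewrite big_ord_recl /with_head unlift_none /=.
  under eq_bigr => i _ do rewrite liftK /=.
  by exists (g ord0), (fun i => g (lift ord0 i)).
exists (fun i => oapp g g0 (unlift ord0 i)).
rewrite big_ord_recl /with_head unlift_none /=.
by under eq_bigr => i _ do rewrite liftK /=.
Qed.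
End Reductions.

Theorem theorem1p4 :
  exists (P : fp_module) (m : nat) (h : 'I_m -> sdprodZ (fp_quot P)),
    [/\ finitely_generated (sdprodZ (fp_quot P)),
        abelian_by_cyclic (sdprodZ (fp_quot P)),
        ~ decidable_problem (@enc_elt_input P) (fun h0 =>
            exists (g0 : sdprodZ (fp_quot P)) (g : 'I_m -> sdprodZ (fp_quot P)),
              (g0 * elt_of_input h0 * g0^-1 *
                 \prod_(i < m) (g i * h i * (g i)^-1) = 1)%g)
      & ~ decidable_problem (@enc_quadratic_input P)
            (@equation_solvable P)].
Proof.
have [e1 [e2 Ke]] := dioph_int dioph_diagonal.
have [x xE] := coef_inputP e1 e2.
exists (cube_module (size (unknowns e1 e2)).+1), (size (unknowns e1 e2)).
exists (fun i => elt_of_input (x i)).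
have solvableE n :
    (exists g0 (g : 'I_(size (unknowns e1 e2)) -> sdprodZ _),
       (g0 * elt_of_input (conj_input e1 e2 n) * g0^-1 *
         \prod_i (g i * elt_of_input (x i) * (g i)^-1) = 1)%g) <-> diagonal n.
  rewrite Ke -system_solvable -conj_equationP elt_of_conj_input.
  split=> -[g0 [g Eg]]; exists g0, g; move: Eg.
    by under eq_bigr => i _ do rewrite xE.
  by under eq_bigr => i _ do rewrite -xE.
split.
- exact: cube_finitely_generated.
- exact: sd_abelian_by_cyclic.
- exact: diagonal_undecidable (computable_conj_input e1 e2) solvableE.
apply: diagonal_undecidable (computable_conj_quadratic x) _ => n.
by rewrite with_head_solvable.
Qed.
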